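(* Let $q\in\mathbb{K}_{\mathbb{R}}[x,y]$ be a generic quartic polynomial such that $\Gamma=\mathrm{Trop}\,V(q)$ is smooth and generic, let $\Lambda$ be a tropical bitangent to $\Gamma$, and let $(\ell,p,p')$ be a bitangent triple lifting $\Lambda$. If $\ell$ is defined over $\mathbb{K}_{\mathbb{R}}$, then so are both tangency points $p$ and $p'$.
   Context: Fields. $\mathbb{K}_{\mathbb{R}}$ is a real closed complete non-Archimedean valued field with non-trivial valuation and a splitting $w\mapsto t^w$; $\mathbb{K}$ is its algebraic closure. Initial forms of elements of $\mathbb{K}_{\mathbb{R}}$ are viewed as real numbers. Tropicalization uses the max convention: $\mathrm{Trop}$ is coordinatewise negative valuation (followed by closure). Quartics. $\Gamma$ smooth means that the Newton subdivision of $q$ is a unimodular triangulation of $\mathrm{conv}\{(0,0),(4,0),(0,4)\}$. Bitangents. Tropical lines $\Lambda$ are non-degenerate (a vertex and three ends with directions $(-1,0),(0,-1),(1,1)$). $\Lambda$ is bitangent to $\Gamma$ if either $\Lambda\cap\Gamma$ has two connected components, each with stable intersection multiplicity 2, or $\Lambda\cap\Gamma$ is connected with stable intersection multiplicity 4. Its tangency points $P,P'$ are points of $\Lambda\cap\Gamma$ (one in each component in the first case) with $2P+2P'$ linearly equivalent to the stable intersection divisor $\Gamma\cap_{st}\Lambda$ on the metric graph $\Gamma$ through a piecewise linear function locally constant outside $\Lambda\cap\Gamma$. Lifts. A bitangent triple $(\ell,p,p')$ of $V(q)$ consists of a bitangent line $\ell=y+m+nx$ ($m,n\in\mathbb{K}^*$)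 to $V(q)$ over $\mathbb{K}$ and its tangency points $p,p'$. It lifts $\Lambda$ if $\mathrm{Trop}\,\ell=\Lambda$ and $\mathrm{Trop}\,p,\mathrm{Trop}\,p'$ are the tangency points of $\Lambda$. The line is defined over $\mathbb{K}_{\mathbb{R}}$ if $m,n\in\mathbb{K}_{\mathbb{R}}$; a point is defined over $\mathbb{K}_{\mathbb{R}}$ if its coordinates lie in $\mathbb{K}_{\mathbb{R}}$. Genericity. (i) If $\Gamma$ has a vertex adjacent to three bounded edges with directions $(-1,0),(0,-1),(1,1)$, then the minimum of their three lengths is attained by exactly one edge; (ii) $V(q)$ has no hyperflexes; (iii) the coefficients of $q$ are generic enough so that whenever both tangency points of a tropical bitangent lie in the relative interior of the same end, the two local tangency systems ($q=\ell=\det\mathrm{Jac}(q,\ell;x,y)=0$ near each point, determining $m$, $m/n$ or $n$ for the horizontal, vertical or diagonal end) are inconsistent. *)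

(* Defs.v *)
From HB Require Import structures.
From mathcomp Require Import all_boot all_order all_algebra.
From mathcomp Require Import all_classical all_reals all_analysis.
From mathcomp Require Import complex.

Set Implicit Arguments.
Unset Strict Implicit.
Unset Printing Implicit Defensive.

Import Order.TTheory GRing.Theory Num.Theory.
Import numFieldNormedType.Exports.

Local Open Scope classical_set_scope.
Local Open Scope ring_scope.

(* A complete non-Archimedean valuation on the real closed field KR, with values
   in the real numbers R.  Convexity of the valuation ring for the order of KR
   is not an axiom: it follows from completeness (Henselianity). *)
Record valued_field (R : realType) (KR : rcfType) := ValuedField {
  vval : KR -> \bar R;
  val_eqy : forall x, vval x = +oo%E <-> x = 0;
  val_neqNy : forall x, vval x <> -oo%E;
  valM : forall x y, vval (x * y) = (vval x + vval y)%E;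
  valD : forall x y, (Order.min (vval x) (vval y) <= vval (x + y))%E;
  val_nontrivial : exists2 x, x != 0 & vval x <> 0%E;
  val_complete : forall u : nat -> KR,
    (forall e : R, exists N : nat, forall i j : nat,
      (N <= i)%N -> (N <= j)%N -> (e%:E < vval (u i - u j))%E) ->
    exists l : KR, forall e : R, exists N : nat, forall i : nat,
      (N <= i)%N -> (e%:E < vval (u i - l))%E;
  (* the splitting w |-> t^w; its values off the value group are irrelevant *)
  value_group := [set w : R | exists x, vval x = w%:E];
  tpow : R -> KR;
  val_tpow : forall w, value_group w -> vval (tpow w) = w%:E;
  tpowD : forall w w', value_group w -> value_group w' ->
    tpow (w + w') = tpow w * tpow w';
  (* reduction modulo the maximal ideal, with the residue field embedded in the
     real numbers; its values off the valuation ring are irrelevant.  The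
     initial form of x != 0 is residue (x / tpow (fine (vval x))). *)
  residue : KR -> R;
  residue1 : residue 1 = 1;
  residueD : forall x y, (0 <= vval x)%E -> (0 <= vval y)%E ->
    residue (x + y) = residue x + residue y;
  residueM : forall x y, (0 <= vval x)%E -> (0 <= vval y)%E ->
    residue (x * y) = residue x * residue y;
  residue_eq0 : forall x, (0 <= vval x)%E -> (residue x = 0 <-> (0 < vval x)%E)
}.

(* The algebraic closure of KR is KR[i]. *)
Definition in_base (KR : rcfType) (z : KR[i]) : Prop :=
  exists x : KR, z = real_complex KR x.

Definition to_closure (KR : rcfType) (q : {poly {poly KR}}) :
    {poly {poly KR[i]}} :=
  map_poly (map_poly (real_complex KR)) q.

Section Tropicalization.
Variables (R : realType) (KR : rcfType) (V : valued_field R KR).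
Let K := KR[i].

(* Negative valuation on K, for z != 0.  The extension of the valuation of a
   complete field to a quadratic extension is half the valuation of the norm. *)
Definition trop (z : K) : R :=
  - fine (vval V (complex.Re z ^+ 2 + complex.Im z ^+ 2)) / 2.

Definition trop_point (p : K * K) : R * R := (trop p.1, trop p.2).

Definition in_torus (p : K * K) : Prop := p.1 != 0 /\ p.2 != 0.

(* f`_i`_j is the coefficient of x^i y^j *)
Definition tropV (f : {poly {poly K}}) : set (R * R) :=
  closure [set trop_point p | p in
    [set p : K * K | in_torus p /\ f.[p.1, p.2] = 0]].

(* Newton subdivision: the cell dual to the point P consists of the exponents
   of the monomials attaining the maximum of the tropical polynomial at P. *)
Definition trop_monomial (f : {poly {poly K}}) (P : R * R) (e : 'I_5 * 'I_5) :
    R :=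
  trop f`_e.1`_e.2 + e.1%:R * P.1 + e.2%:R * P.2.

Definition newton_cell (f : {poly {poly K}}) (P : R * R) : {set 'I_5 * 'I_5} :=
  [set e : 'I_5 * 'I_5 | (f`_e.1`_e.2 != 0) &&
    [forall e' : 'I_5 * 'I_5, (f`_e'.1`_e'.2 != 0) ==>
       (trop_monomial f P e' <= trop_monomial f P e)]]%SET.

End Tropicalization.

Definition triangle_det (u v w : 'I_5 * 'I_5) : int :=
  (v.1%:Z - u.1%:Z) * (w.2%:Z - u.2%:Z) - (v.2%:Z - u.2%:Z) * (w.1%:Z - u.1%:Z).

Definition full_dimensional (T : {set 'I_5 * 'I_5}) : Prop :=
  exists u v w, [/\ u \in T, v \in T, w \in T & triangle_det u v w != 0].

Definition unimodular_triangle (T : {set 'I_5 * 'I_5}) : Prop :=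
  exists u v w, T = [set u; v; w]%SET /\ `|triangle_det u v w| = 1.

Definition quartic (A : nzRingType) (f : {poly {poly A}}) : Prop :=
  forall i j : nat, f`_i`_j != 0 -> (i + j <= 4)%N.

Definition trop_smooth (R : realType) (KR : rcfType) (V : valued_field R KR)
    (f : {poly {poly KR[i]}}) : Prop :=
  (* the Newton polygon of the quartic f is the whole triangle *)
  [/\ f`_0`_0 != 0, f`_4`_0 != 0, f`_0`_4 != 0
    & forall P : R * R, full_dimensional (newton_cell V f P) ->
        unimodular_triangle (newton_cell V f P)].

Section TropicalLines.
Variable R : realType.

Definition ray (P d : R * R) (s : R) : R * R :=
  (P.1 + s * d.1, P.2 + s * d.2).

(* directions of the horizontal, vertical and diagonal ends *)
Definition end_dir (k : 'I_3) : R * R :=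
  nth (0, 0) [:: (-1, 0); (0, -1); (1, 1)] k.

Definition open_end (c : R * R) (k : 'I_3) : set (R * R) :=
  [set P | exists2 s : R, 0 < s & P = ray c (end_dir k) s].

Definition trop_line (c : R * R) : set (R * R) :=
  [set c] `|` \bigcup_k open_end c k.

(* slope in direction d of the tropical polynomial at a point with dual cell T *)
Definition cell_slope (T : {set 'I_5 * 'I_5}) (d : R * R) : R :=
  sup [set e.1%:R * d.1 + e.2%:R * d.2 | e in [set e : 'I_5 * 'I_5 | e \in T]].

Definition int_dir (d : int * int) : R * R := (d.1%:~R, d.2%:~R).

(* primitive directions of the edges of a tropical curve G emanating from P *)
Definition edge_dirs (G : set (R * R)) (P : R * R) : set (int * int) :=
  [set d | coprimez d.1 d.2 /\
    exists2 e : R, 0 < e & forall s, 0 <= s <= e -> G (ray P (int_dir d) s)].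

End TropicalLines.

Section Bitangents.
Variables (R : realType) (KR : rcfType) (V : valued_field R KR).
Let K := KR[i].
Implicit Types (f : {poly {poly K}}) (c P Q : R * R) (p z : K * K) (m n : K).

(* Multiplicity at P of the stable intersection of Trop V(f) with the tropical
   line of vertex c: the divisor on the line of the restriction of the tropical
   polynomial of f, that is, the sum of its outgoing slopes along the line.
   Equivalently, the mixed area of the two dual cells at P. *)
Definition stable_mult f c P : R :=
  if P == c then \sum_(k < 3) cell_slope (newton_cell V f P) (end_dir R k)
  else \sum_(k < 3 | `[< open_end c k P >])
         (cell_slope (newton_cell V f P) (end_dir R k)
          + cell_slope (newton_cell V f P) (- end_dir R k)).

Definition meet_line f c : set (R * R) := trop_line c `&` tropV V f.

Definition stable_degree f c (C : set (R * R)) : R :=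
  \sum_(P \in C) stable_mult f c P.

Definition trop_bitangent f c : Prop :=
  (connected (meet_line f c) /\ stable_degree f c (meet_line f c) = 4) \/
  (exists C C' : set (R * R),
     [/\ C <> C',
         [set C; C'] =
           [set connected_component (meet_line f c) P | P in meet_line f c],
         stable_degree f c C = 2 & stable_degree f c C' = 2]).

(* phi is a piecewise linear function on the metric graph Trop V(f) (all edges
   have weight one, and lattice length as metric), with sg Q d its integer slope
   at Q in the direction d, its divisor is the stable intersection minus
   2P + 2P', and it is locally constant outside of the line.  Boundedness means
   that phi has neither zeros nor poles at infinity. *)
Definition tangency_function f c P P' (phi : R * R -> R)
    (sg : R * R -> int * int -> int) : Prop :=
  let G := tropV V f in
  [/\ forall Q, G Q -> forall d, edge_dirs G Q d ->
        exists2 e : R, 0 < e & forall s, 0 <= s <= e ->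
          phi (ray Q (int_dir R d) s) = phi Q + s * (sg Q d)%:~R,
      exists M : R, forall Q, G Q -> `|phi Q| <= M,
      forall Q, G Q ->
        (\sum_(d \in edge_dirs G Q) sg Q d)%:~R
        = stable_mult f c Q - 2 * (Q == P)%:R - 2 * (Q == P')%:R
    & forall Q, G Q -> ~ trop_line c Q ->
        \forall Q' \near Q, G Q' -> phi Q' = phi Q].

Definition tangency_points f c P P' : Prop :=
  [/\ meet_line f c P, meet_line f c P',
      ~ connected (meet_line f c) ->
        connected_component (meet_line f c) P
        <> connected_component (meet_line f c) P'
    & exists phi sg, tangency_function f c P P' phi sg].

(* the polynomial y + m + n x *)
Definition line m n : {poly {poly K}} :=
  'Y + m%:P%:P + n%:P%:P * 'X.

(* f (x, - m - n x) *)
Definition restrict_line f m n : {poly K} :=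
  (map_poly (comp_poly (- m%:P - n *: 'X)) f).['X].

(* intersection multiplicity of V(f) with the line y + m + n x at a point z of
   this line, parametrized by its first coordinate *)
Definition line_mult f m n z : nat := mup z.1 (restrict_line f m n).

(* The line cuts on the quartic V(f) the divisor 2p + 2p'.  All the
   intersection points are then affine, as 2 + 2 = 4. *)
Definition bitangent_triple f m n p p' : Prop :=
  [/\ m != 0 /\ n != 0,
      restrict_line f m n != 0,
      (line m n).[p.1, p.2] = 0 /\ (line m n).[p'.1, p'.2] = 0
    & forall z, (line m n).[z.1, z.2] = 0 ->
        line_mult f m n z = (2 * (z == p) + 2 * (z == p'))%N].

Definition lifts_line f c m n p p' : Prop :=
  [/\ tropV V (line m n) = trop_line c, in_torus p, in_torus p'
    & tangency_points f c (trop_point V p) (trop_point V p')].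

Definition jac_det f g : {poly {poly K}} :=
  f^`() * map_poly (@deriv K) g - map_poly (@deriv K) f * g^`().

Definition local_tangency f m n p : Prop :=
  [/\ f.[p.1, p.2] = 0, (line m n).[p.1, p.2] = 0
    & (jac_det f (line m n)).[p.1, p.2] = 0].

Definition dual_vertex f P : Prop := full_dimensional (newton_cell V f P).

(* from the vertex P there is an edge of Trop V(f) of direction d and length L;
   L is the lattice length when d is primitive *)
Definition bounded_edge f P (d : R * R) (L : R) : Prop :=
  [/\ 0 < L, dual_vertex f P, dual_vertex f (ray P d L)
    & forall s, 0 < s < L ->
        tropV V f (ray P d s) /\ ~ dual_vertex f (ray P d s)].

Definition star_generic f : Prop :=
  forall P (L : 'I_3 -> R),
    (forall k, bounded_edge f P (end_dir R k) (L k)) ->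
    exists k, forall j, j != k -> L k < L j.

(* value at a vector of K^3 of the homogenization of a quartic *)
Definition homog_eval f (u : 'rV[K]_3) : K :=
  \sum_(i < 5) \sum_(j < 5 | (i + j <= 4)%N)
     f`_i`_j * u 0 0 ^+ i * u 0 1 ^+ j * u 0 2%:R ^+ (4 - i - j).

(* no line of the projective plane meets the curve at a single point u: the
   quartic form restricted to the line spanned by u and w is not c * b^4 *)
Definition no_hyperflex f : Prop :=
  ~ exists (u w : 'rV[K]_3) (a : K),
      [/\ row_free (col_mx u w), a != 0
        & forall s b : K, homog_eval f (s *: u + b *: w) = a * b ^+ 4].

(* When both tangency points lie in the relative interior of the same end, the
   two local tangency systems have no common solution (m, n). *)
Definition same_end_generic f : Prop :=
  forall c P P' (k : 'I_3),
    trop_bitangent f c -> tangency_points f c P P' ->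
    open_end c k P -> open_end c k P' ->
    ~ exists m n p p',
        [/\ [/\ m != 0, n != 0 & tropV V (line m n) = trop_line c],
            p != p',
            [/\ in_torus p, trop_point V p = P & local_tangency f m n p]
          & [/\ in_torus p', trop_point V p' = P' & local_tangency f m n p']].

Definition generic f : Prop :=
  [/\ star_generic f, no_hyperflex f & same_end_generic f].

End Bitangents.

(* Main.v *)
(* If [p] is not real then [p'] is its complex conjugate, so both have the same
   tropicalization [P].  If [P] lies in an open end of the tropical line, this is
   excluded by the genericity of the local tangency systems.

   Otherwise [P] is the vertex.  Rescale the coordinates so that the line becomes
   X + Y + Z = 0 with tropical vertex at the origin: the quartic form restricts
   there to [k Q ^+ 2] with [Q] a definite quadratic form whose values at the three
   coordinate points of the line are units, and only the monomials of the dual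
   cell, which lies in a unimodular triangle, survive in the residue field.

   If [k] has a non-zero residue, the triangle touches the three sides of the
   Newton polygon.  Up to symmetry there are two such triangles; their trinomials
   are never the square of a definite form.  If [k] reduces to zero, the trinomial
   vanishes on the line, so the dual cell is a translate of the unit triangle and
   the curve contains the star of the tropical line.  Evaluating [k Q ^+ 2] near the
   three coordinate points then shows that the three edges of the star are bounded,
   all of length the valuation of [k], against [star_generic]. *)

Require Import Defs.
From mathcomp Require Import all_boot all_order all_algebra.
From mathcomp Require Import all_classical all_reals all_analysis.
From mathcomp Require Import complex.
From mathcomp Require Import ring lra zify.

Set Implicit Arguments.
Unset Strict Implicit.
Unset Printing Implicit Defensive.

Import Order.TTheory GRing.Theory Num.Theory.
Import numFieldNormedType.Exports.

Local Open Scope ring_scope.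

(** * Valuation ring, units and residues of the real closed base field *)

Section ValuationRing.
Variables (R : realType) (KR : rcfType) (V : valued_field R KR).
Implicit Types x y z : KR.
Local Notation v := (vval V).
Local Notation res := (residue V).

Definition integral x : bool := (0 <= v x)%E.
Local Notation O := integral.

(* The value of [x], with the junk value [0] at [x = 0]. *)
Definition rval x : R := fine (v x).

Lemma val0 : v 0 = +oo%E.
Proof. by apply/(val_eqy V). Qed.

Lemma rvalE x : x != 0 -> v x = (rval x)%:E.
Proof.
move=> x0; rewrite /rval; case E: (v x) => [r| |] //.
- by move/(val_eqy V): E x0 => ->; rewrite eqxx.
- by case: (@val_neqNy _ _ V x).
Qed.

Lemma rvalM x y : x != 0 -> y != 0 -> rval (x * y) = rval x + rval y.
Proof.
move=> x0 y0; have := Defs.valM V x y.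
by rewrite !rvalE ?mulf_neq0// -EFinD => -[].
Qed.

Lemma rval1 : rval 1 = 0.
Proof.
have := @rvalM 1 1 (oner_neq0 _) (oner_neq0 _); rewrite mulr1.
by move=> h; lra.
Qed.

Lemma rvalV x : x != 0 -> rval x^-1 = - rval x.
Proof.
move=> x0; have xv0 : x^-1 != 0 by rewrite invr_eq0.
have := rvalM x0 xv0; rewrite mulfV// rval1 => h; lra.
Qed.

Lemma rvalX x k : x != 0 -> rval (x ^+ k) = rval x *+ k.
Proof.
move=> x0; elim: k => [|k IH]; first by rewrite expr0 rval1.
by rewrite exprS rvalM ?expf_neq0// IH mulrS.
Qed.

Lemma rvalN x : rval (- x) = rval x.
Proof.
have [->|x0] := eqVneq x 0; first by rewrite oppr0.
rewrite -mulN1r rvalM ?oppr_eq0 ?oner_neq0//.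
suff -> : rval (-1) = 0 by rewrite add0r.
have n0 : (-1 : KR) != 0 by rewrite oppr_eq0 oner_neq0.
have := rvalM n0 n0; rewrite mulrNN mulr1 rval1 => h; lra.
Qed.

Lemma integralE x : O x = (x == 0) || (0 <= rval x).
Proof.
rewrite /integral; have [->|x0] := eqVneq x 0; first by rewrite val0 leey.
by rewrite rvalE.
Qed.

Lemma integral0 : O 0. Proof. by rewrite integralE eqxx. Qed.

Lemma integral1 : O 1. Proof. by rewrite integralE rval1 lexx orbT. Qed.

Lemma integralM x y : O x -> O y -> O (x * y).
Proof. by rewrite /integral Defs.valM; apply: adde_ge0. Qed.

Lemma integralD x y : O x -> O y -> O (x + y).
Proof.
rewrite /integral => ox oy; apply: le_trans (valD V x y).
by rewrite le_min ox oy.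
Qed.

Lemma integralN x : O (- x) = O x.
Proof. by rewrite !integralE oppr_eq0 rvalN. Qed.

Lemma integralB x y : O x -> O y -> O (x - y).
Proof. by move=> ox oy; rewrite integralD// integralN. Qed.

Lemma integralX x k : O x -> O (x ^+ k).
Proof.
move=> ox; elim: k => [|k IH]; first by rewrite expr0 integral1.
by rewrite exprS integralM.
Qed.

Lemma integral_nat k : O k%:R.
Proof.
elim: k => [|k IH]; first exact: integral0.
by rewrite -addn1 natrD integralD ?integral1.
Qed.

Lemma integral_sum (I : Type) (r : seq I) (P : pred I) (F : I -> KR) :
  (forall i, P i -> O (F i)) -> O (\sum_(i <- r | P i) F i).
Proof.
move=> h; apply: (big_ind (fun x => O x)) => //; first exact: integral0.
exact: integralD.
Qed.

Lemma residue_mul x y : O x -> O y -> res (x * y) = res x * res y.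
Proof. exact: residueM. Qed.

Lemma residue_add x y : O x -> O y -> res (x + y) = res x + res y.
Proof. exact: residueD. Qed.

Lemma residue0 : res 0 = 0.
Proof. by apply/residue_eq0; rewrite val0 ?leey ?ltey. Qed.

Lemma residueN x : O x -> res (- x) = - res x.
Proof.
move=> ox; have onx : O (- x) by rewrite integralN.
by apply/eqP; rewrite -addr_eq0 -residueD// addNr residue0.
Qed.

Lemma residueB x y : O x -> O y -> res (x - y) = res x - res y.
Proof.
move=> ox oy; have ony : O (- y) by rewrite integralN.
by rewrite residueD// residueN.
Qed.

Lemma residueX x k : O x -> res (x ^+ k) = res x ^+ k.
Proof.
move=> ox; elim: k => [|k IH]; first by rewrite !expr0 residue1.
by rewrite !exprS residueM ?IH//; apply: integralX.
Qed.

Lemma residue_nat k : res k%:R = k%:R.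
Proof.
elim: k => [|k IH]; first exact: residue0.
rewrite -addn1 !natrD residueD ?residue1 ?IH//; [exact: integral_nat|].
exact: integral1.
Qed.

Lemma integral_int (z : int) : O z%:~R.
Proof.
case: z => k; first by rewrite -pmulrn integral_nat.
by rewrite NegzE mulrNz -pmulrn integralN integral_nat.
Qed.

Lemma residue_int (z : int) : res z%:~R = z%:~R.
Proof.
case: z => k; first by rewrite -!pmulrn residue_nat.
by rewrite NegzE !mulrNz -!pmulrn residueN ?integral_nat// residue_nat.
Qed.

Lemma residue_sum (I : Type) (r : seq I) (P : pred I) (F : I -> KR) :
  (forall i, P i -> O (F i)) ->
  res (\sum_(i <- r | P i) F i) = \sum_(i <- r | P i) res (F i).
Proof.
move=> h; pose K x (y : R) := O x /\ res x = y.
suff [] : K (\sum_(i <- r | P i) F i) (\sum_(i <- r | P i) res (F i)) by [].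
apply: (big_ind2 K) => [|x y x' y' [ox <-] [ox' <-]|i Pi].
- by split; [exact: integral0|exact: residue0].
- by split; [exact: integralD|exact: residueD].
- by split=> //; exact: h.
Qed.

Lemma residue_neq0 x : x != 0 -> O x -> (res x != 0) = (rval x == 0).
Proof.
move=> x0 ox; have := ox; rewrite integralE (negbTE x0) /= => rx.
have [e1 e2] := residue_eq0 ox; rewrite rvalE// lte_fin in e1 e2.
apply/idP/idP => [/eqP h|/eqP h].
  by rewrite eq_le rx andbT leNgt; apply/negP => /e2.
by apply/eqP => /e1; rewrite h ltxx.
Qed.

Definition vunit x : bool := (x != 0) && (rval x == 0).

Lemma vunit_neq0 x : vunit x -> x != 0. Proof. by case/andP. Qed.

Lemma vunit_integral x : vunit x -> O x.
Proof. by case/andP=> x0 /eqP rx; rewrite integralE rx lexx orbT. Qed.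

Lemma vunitP x : reflect (O x /\ res x <> 0) (vunit x).
Proof.
apply: (iffP idP) => [ux|[ox /eqP rx]].
  split; first exact: vunit_integral.
  by apply/eqP; rewrite residue_neq0 ?vunit_integral ?vunit_neq0//; case/andP: ux.
have x0 : x != 0 by apply: contra_neq rx => ->; rewrite residue0.
by rewrite /vunit x0 -residue_neq0.
Qed.

Lemma vunitM x y : vunit x -> vunit y -> vunit (x * y).
Proof.
move=> /andP[x0 /eqP rx] /andP[y0 /eqP ry].
by rewrite /vunit mulf_neq0// rvalM// rx ry addr0 eqxx.
Qed.

Lemma vunitV x : vunit x -> vunit x^-1.
Proof.
by move=> /andP[x0 /eqP rx]; rewrite /vunit invr_eq0 x0 rvalV// rx oppr0 eqxx.
Qed.

Lemma vunitX x k : vunit x -> vunit (x ^+ k).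
Proof. by move=> /andP[x0 /eqP rx]; rewrite /vunit expf_neq0// rvalX// rx mul0rn eqxx. Qed.

Lemma vunit_nat k : (0 < k)%N -> vunit k%:R.
Proof.
move=> k0; apply/vunitP; split; first exact: integral_nat.
by rewrite residue_nat; apply/eqP; rewrite pnatr_eq0 -lt0n.
Qed.

Lemma vunitN x : vunit (- x) = vunit x.
Proof. by rewrite /vunit oppr_eq0 rvalN. Qed.

Lemma integralV x : ~~ O x -> O x^-1 /\ res x^-1 = 0.
Proof.
rewrite integralE negb_or -ltNge => /andP[x0 rx].
have ox : O x^-1 by rewrite integralE rvalV// oppr_ge0 (ltW rx) orbT.
split=> //; apply/eqP/negPn; rewrite residue_neq0 ?invr_eq0//.
by rewrite rvalV// oppr_eq0 lt_eqF.
Qed.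

(** A nonnegative element is the square of its square root, which is again integral, so its residue
    is a square. All compatibility between order and valuation rests on this. *)
Lemma residue_ge0 x : O x -> 0 <= x -> 0 <= res x.
Proof.
move=> ox x0; have [sE|s0] := eqVneq (Num.sqrt x) 0.
  by rewrite -(sqr_sqrtr x0) sE expr0n residue0.
have os : O (Num.sqrt x).
  have := ox; rewrite -{1}(sqr_sqrtr x0) !integralE expf_eq0 /= (negbTE s0) /=.
  by rewrite rvalX// pmulrn_lge0.
by rewrite -(sqr_sqrtr x0) residueX// sqr_ge0.
Qed.

Lemma residue_le x y : O x -> O y -> x <= y -> res x <= res y.
Proof.
by move=> ox oy xy; rewrite -subr_ge0 -residueB// residue_ge0 ?integralB// subr_ge0.
Qed.

(** If [x] were not integral, [x^-1] would have residue 0, whereas [1 <= x^-1 * y] forces the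
    residue of the product to be at least 1. *)
Lemma integral_between x y : O y -> 0 <= x <= y -> O x.
Proof.
move=> oy /andP[x0 xy]; apply/negPn/negP => /[dup] nx /integralV[ox rx].
have x1 : 0 < x.
  by rewrite lt_neqAle x0 andbT eq_sym; apply: contraNneq nx => ->; exact: integral0.
have : 1 <= res (x^-1 * y).
  rewrite -(residue1 V); apply: residue_le; [exact: integral1|exact: integralM|].
  by rewrite mulrC ler_pdivlMr// mul1r.
by rewrite residueM// rx mul0r ler10.
Qed.

Lemma vunit_between x y z : vunit x -> O z -> 0 < x -> x <= y <= z -> vunit y.
Proof.
move=> ux oz x0 /andP[xy yz]; have oy : O y.
  by apply: (integral_between oz); rewrite yz (le_trans (ltW x0) xy).
apply/vunitP; split=> // ry.
have := residue_le (vunit_integral ux) oy xy.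
have := residue_ge0 (vunit_integral ux) (ltW x0).
by case/vunitP: ux => _ rx; rewrite ry => h1 h2; apply: rx; lra.
Qed.

Lemma rval_nat k : (0 < k)%N -> rval k%:R = 0.
Proof. by move=> /vunit_nat/andP[_ /eqP]. Qed.

Lemma trop_real x : x != 0 -> trop V (real_complex KR x) = - rval x.
Proof.
move=> x0; rewrite /trop /= expr0n addr0 -/(rval _) rvalX//.
by rewrite mulr2n; lra.
Qed.

Lemma ex_rval_gt0 : exists2 x, x != 0 & 0 < rval x.
Proof.
have [x x0 vx] := val_nontrivial V.
have rx : rval x != 0 by apply/eqP => h; apply: vx; rewrite rvalE// h.
case/orP: (lt_total rx) => h; last by exists x.
by exists x^-1; rewrite ?invr_eq0// rvalV// oppr_gt0.
Qed.

(* Square roots of positive elements make the value group divisible by 2. *)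
Lemma rval_dense (a b : R) : a < b -> exists2 x, x != 0 & a < rval x < b.
Proof.
move=> ab; have [x x0 rx] := ex_rval_gt0.
(* Starting from [x ^+ 2] instead of [x] gives a positive element, of which square roots can be
   taken repeatedly. *)
have H (k : nat) : exists2 y, 0 < y & rval y *+ 2 ^ k = rval x *+ 2.
  elim: k => [|k [y y0 ey]].
    by exists (x ^+ 2); rewrite ?exprn_even_gt0// rvalX.
  have sy : 0 < Num.sqrt y by rewrite sqrtr_gt0.
  by exists (Num.sqrt y); rewrite // expnS mulrnA -(rvalX 2 (lt0r_neq0 sy)) sqr_sqrtr ?ltW.
have [k hk] : exists k : nat, rval x *+ 2 < (b - a) *+ 2 ^ k.
  have ba : 0 < b - a by lra.
  exists (Num.bound (rval x *+ 2 / (b - a))).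
  rewrite -[X in _ < X]mulr_natr -ltr_pdivrMl// mulrC.
  apply: lt_trans (archi_boundP _) _; last by rewrite ltr_nat ltn_expl.
  by rewrite divr_ge0 ?mulrn_wge0 ?ltW.
have [y y0 ey] := H k.
have ry : 0 < rval y.
  have : 0 < rval y *+ 2 ^ k by rewrite ey pmulrn_lgt0.
  by rewrite pmulrn_lgt0// expn_gt0.
have ryb : rval y < b - a.
  by move: hk; rewrite -ey ltr_pMn2r// expn_gt0.
(* As [rval y < b - a], the first multiple of [rval y] beyond [a] is still below [b]. *)
pose j := Num.floor (a / rval y) + 1.
exists (y ^ j); first by rewrite expfz_neq0// gt_eqF.
have yE : rval (y ^ j) = rval y * j%:~R.
  case: j => j; first by rewrite -exprnP rvalX ?gt_eqF// mulr_natr.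
  rewrite -[y ^ Negz j]/(y ^- j.+1) rvalV ?expf_neq0 ?gt_eqF// rvalX ?gt_eqF//.
  by rewrite NegzE mulrNz mulrN mulr_natr.
rewrite yE; have h1 := floor_le (a / rval y).
have h2 := floorD1_gt (a / rval y).
move: h1; rewrite ler_pdivlMr// => h1; move: h2; rewrite ltr_pdivrMr// => h2.
rewrite /j; apply/andP; split; first by rewrite mulrC.
by rewrite intrD mulrDr mulr1 mulrC; lra.
Qed.

End ValuationRing.

(** * Maximizers of finitely many affine functions along a ray *)

Section RayShooting.
Variables (R : realFieldType) (I : finType) (S : pred I) (h s : I -> R).

Definition maximizers (t : R) : {set I} :=
  [set e | S e && [forall e', S e' ==> (h e' + t * s e' <= h e + t * s e)]].

Lemma maximizersP t e :
  reflect (S e /\ forall e', S e' -> h e' + t * s e' <= h e + t * s e)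
          (e \in maximizers t).
Proof.
rewrite inE; apply: (iffP andP) => -[Se].
  by move/forallP => H; split=> // e' Se'; have := H e'; rewrite Se'.
by move=> H; split=> //; apply/forallP => e'; apply/implyP/H.
Qed.

(** [L] is the first time at which a function steeper than [u] catches up with [u]. Before it, only
    the functions tied with [u] both in initial value and in slope are maximal. *)
Lemma maximizers_along_ray u e0 :
  u \in maximizers 0 -> (forall e, e \in maximizers 0 -> s e <= s u) ->
  S e0 -> s u < s e0 ->
  exists L, [/\ 0 < L,
    forall t, 0 < t < L -> maximizers t = [set e in maximizers 0 | s e == s u],
    forall e, e \in maximizers 0 -> s e = s u -> e \in maximizers L
    & exists2 w, w \in maximizers L & s u < s w].
Proof.
move=> /maximizersP[Su mu] sl Se0 se0.
have {}mu e : S e -> h e <= h u by move=> /mu; rewrite !mul0r !addr0.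
(* [P] selects the functions steeper than [u], and [g e] is the time at which [e] meets [u]. *)
pose P e := S e && (s u < s e); pose g e := (h u - h e) / (s e - s u).
have Pe0 : P e0 by rewrite /P Se0.
have g0 e : P e -> 0 < g e.
  case/andP=> Se se; apply: divr_gt0; last by rewrite subr_gt0.
  rewrite subr_gt0 lt_neqAle mu// andbT; apply/eqP => he.
  suff /sl : e \in maximizers 0 by rewrite leNgt se.
  by apply/maximizersP; split=> // e' Se'; rewrite !mul0r !addr0 he mu.
have gE e : P e -> h e = h u - g e * (s e - s u).
  by case/andP=> _ se; rewrite /g divfK ?subKr// subr_eq0 gt_eqF.
case: (arg_minP g Pe0) => w Pw gw.
have m0 e : e \in maximizers 0 -> S e /\ h e = h u.
  case/maximizersP => Se /(_ _ Su); rewrite !mul0r !addr0 => hu.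
  by split=> //; apply/le_anti; rewrite mu.
have bound t e : 0 <= t <= g w -> S e -> h e + t * s e <= h u + t * s u.
  move=> /andP[t0 tg] Se; have [se|se] := ltP (s u) (s e).
    have Pe : P e by rewrite /P Se.
    have := gw _ Pe; have := gE _ Pe => -> gwe.
    have : 0 <= (g e - t) * (s e - s u) by apply: mulr_ge0; lra.
    by move=> H; lra.
  have := mu _ Se; have : 0 <= t * (s u - s e) by apply: mulr_ge0; lra.
  by move=> *; lra.
exists (g w); split; first exact: g0.
- move=> t /andP[t0 tg]; apply/setP => e; rewrite [RHS]inE.
  apply/idP/andP => [/maximizersP[Se /(_ _ Su) He]|[/m0[Se he] /eqP se]]; last first.
    apply/maximizersP; split=> // e' Se'; rewrite he se; apply: bound => //.
    by rewrite !ltW.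
  have := mu _ Se; have [se|se|se] := ltrgtP (s u) (s e) => hu.
  + have Pe : P e by rewrite /P Se.
    have := gw _ Pe; have := gE _ Pe => hE gwe; exfalso.
    have : 0 < (g e - t) * (s e - s u) by apply: mulr_gt0; lra.
    by move=> H; lra.
  + have : 0 < t * (s u - s e) by apply: mulr_gt0; lra.
    by move=> *; exfalso; lra.
  + split=> //.
    apply/maximizersP; split=> // e' /mu; rewrite !mul0r !addr0 => *.
    by rewrite se in He; lra.
- move=> e /m0[Se he] se; apply/maximizersP; split=> // e' Se'.
  by rewrite he se; apply: bound => //; rewrite lexx ltW ?g0.
- exists w; last by case/andP: Pw.
  apply/maximizersP; split=> [|e' Se']; first by case/andP: Pw.
  apply: le_trans (bound (g w) _ _ Se') _; first by rewrite lexx ltW ?g0.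
  by rewrite (gE _ Pw); lra.
Qed.

End RayShooting.

(** * Cells of the Newton subdivision and their enlargement *)

Section NewtonCells.
Variables (R : realType) (KR : rcfType) (V : valued_field R KR).
Variable f : {poly {poly KR[i]}}.
Implicit Types (P d : R * R) (u v w e : 'I_5 * 'I_5).

Definition dot e d : R := e.1%:R * d.1 + e.2%:R * d.2.

Definition in_support e : bool := f`_e.1`_e.2 != 0.

Lemma trop_monomial_ray P d t e :
  trop_monomial V f (ray P d t) e = trop_monomial V f P e + t * dot e d.
Proof. by rewrite /trop_monomial /ray /dot /=; ring. Qed.

Lemma newton_cell_ray P d t :
  newton_cell V f (ray P d t) =
  maximizers in_support (trop_monomial V f P) (dot^~ d) t.
Proof.
apply/setP => e; rewrite !inE /in_support; congr (_ && _).
by apply: eq_forallb => e'; rewrite !trop_monomial_ray.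
Qed.

Lemma ray0 P d : ray P d 0 = P.
Proof. by rewrite /ray !mul0r !addr0; case: P. Qed.

Lemma newton_cell0 P d :
  newton_cell V f P = maximizers in_support (trop_monomial V f P) (dot^~ d) 0.
Proof. by rewrite -newton_cell_ray ray0. Qed.

Lemma newton_cell_along_ray P d u e0 :
  u \in newton_cell V f P ->
  (forall e, e \in newton_cell V f P -> dot e d <= dot u d) ->
  in_support e0 -> dot u d < dot e0 d ->
  exists L, [/\ 0 < L,
    forall t, 0 < t < L ->
      newton_cell V f (ray P d t) = [set e in newton_cell V f P | dot e d == dot u d],
    forall e, e \in newton_cell V f P -> dot e d = dot u d ->
      e \in newton_cell V f (ray P d L)
    & exists2 w, w \in newton_cell V f (ray P d L) & dot u d < dot w d].
Proof.
rewrite (newton_cell0 P d) => uP le_u Se0 lt0.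
have [L [L0 H1 H2 [w wL lw]]] := maximizers_along_ray uP le_u Se0 lt0.
exists L; split=> //.
- by move=> t /H1; rewrite newton_cell_ray.
- by move=> e eP de; rewrite newton_cell_ray H2.
- by exists w; rewrite // newton_cell_ray.
Qed.

Lemma newton_cellP P e :
  reflect (in_support e /\ forall e', in_support e' ->
             trop_monomial V f P e' <= trop_monomial V f P e)
          (e \in newton_cell V f P).
Proof.
rewrite inE; apply: (iffP andP) => -[Se].
  by move/forallP => H; split=> // e' Se'; have := H e'; rewrite [_ != _]Se'.
by move=> H; split=> //; apply/forallP => e'; apply/implyP/H.
Qed.

Lemma newton_cell_neq0 P e0 : in_support e0 -> exists u, u \in newton_cell V f P.
Proof.
move=> Se0; case: (arg_maxP (trop_monomial V f P) Se0) => u Su mu.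
by exists u; apply/newton_cellP; split.
Qed.

(** The direction is [v - u] after a quarter turn: the determinant is the height of [e] above the
    line through [u] and [v]. *)
Lemma triangle_detE u v e : (triangle_det u v e)%:~R =
  dot e (- (v.2%:R - u.2%:R), v.1%:R - u.1%:R)
  - dot u (- (v.2%:R - u.2%:R), v.1%:R - u.1%:R) :> R.
Proof.
by rewrite /triangle_det /dot /= !(rmorphB, rmorphM) /= -!pmulrn; ring.
Qed.

Definition ord4 : 'I_5 := inord 4.
Lemma val_ord4 : ord4 = 4%N :> nat. Proof. by rewrite inordK. Qed.

Hypotheses (S00 : in_support (ord0, ord0)) (S40 : in_support (ord4, ord0))
  (S04 : in_support (ord0, ord4)).

Lemma not_collinear_corners (a b a' b' : int) :
  (a' - a) * (0 - b) - (b' - b) * (0 - a) = 0 ->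
  (a' - a) * (0 - b) - (b' - b) * (4 - a) = 0 ->
  (a' - a) * (4 - b) - (b' - b) * (0 - a) = 0 -> a' = a /\ b' = b.
Proof. by move=> E0 E1 E2; split; lia. Qed.

(** One moves along a ray on which the monomials of the cell stay tied while some other monomial of
    the support gains on them; the first to catch up enlarges the cell. *)
Lemma newton_cell_grow P : ~ full_dimensional (newton_cell V f P) ->
  exists P', newton_cell V f P \proper newton_cell V f P'.
Proof.
move=> nfd; have [u uP] := newton_cell_neq0 P S00.
suff [d [e [Se lt_e eq_d]]] : exists d e, [/\ in_support e, dot u d < dot e d
    & forall e', e' \in newton_cell V f P -> dot e' d = dot u d].
  have le_d e' : e' \in newton_cell V f P -> dot e' d <= dot u d.
    by move/eq_d ->.
  have [L [L0 _ H [w wL lw]]] := newton_cell_along_ray uP le_d Se lt_e.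
  exists (ray P d L); apply/properP; split.
    by apply/fintype.subsetP => e' e'P; apply: H => //; exact: eq_d.
  by exists w => //; apply/negP => /eq_d h; rewrite h ltxx in lw.
have [/existsP[v /andP[vP vu]]|no_v] :=
  boolP [exists v, (v \in newton_cell V f P) && (v != u)]; last first.
  have uni e' : e' \in newton_cell V f P -> e' = u.
    move=> e'P; apply/eqP/negPn/negP => ne.
    by move/existsP: no_v; apply; exists e'; rewrite e'P.
  have [e Se ne] : exists2 e, in_support e & e != u.
    by have [uE|] := eqVneq (ord0, ord0) u; [exists (ord4, ord0)|exists (ord0, ord0)];
      rewrite // -uE xpair_eqE -val_eqE /= val_ord4.
  (* The cell is the single point [u]; in the direction [e - u] the monomial [e] gains at the rate
     of the squared distance. *)
  exists (e.1%:R - u.1%:R, e.2%:R - u.2%:R), e; split=> //; last by move=> e' /uni ->.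
  rewrite -subr_gt0 /dot /=.
  have -> : e.1%:R * (e.1%:R - u.1%:R) + e.2%:R * (e.2%:R - u.2%:R) -
    (u.1%:R * (e.1%:R - u.1%:R) + u.2%:R * (e.2%:R - u.2%:R)) =
    (e.1%:R - u.1%:R) ^+ 2 + (e.2%:R - u.2%:R) ^+ 2 :> R by ring.
  rewrite lt_neqAle addr_ge0 ?sqr_ge0// andbT eq_sym paddr_eq0 ?sqr_ge0//.
  rewrite !expf_eq0 /= !subr_eq0 !eqr_nat.
  by apply: contra ne => /andP[/eqP h1 /eqP h2]; apply/eqP; case: (e) (u) h1 h2
    => [a b] [a' b'] /= h1 h2; congr pair; apply/val_inj.
have col e : e \in newton_cell V f P -> triangle_det u v e = 0.
  move=> eP; apply/eqP/negPn/negP => ne; apply: nfd.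
  by exists u, v, e; split.
have [e Se ne] : exists2 e, in_support e & triangle_det u v e != 0.
  have [E0|] := eqVneq (triangle_det u v (ord0, ord0)) 0; last by exists (ord0, ord0).
  have [E1|] := eqVneq (triangle_det u v (ord4, ord0)) 0; last by exists (ord4, ord0).
  have [E2|] := eqVneq (triangle_det u v (ord0, ord4)) 0; last by exists (ord0, ord4).
  case/eqP: vu; move: E0 E1 E2; rewrite /triangle_det /= val_ord4.
  case: (u) (v) => [a b] [a' b'] /= E0 E1 E2.
  have [e1 e2] := not_collinear_corners E0 E1 E2.
  by congr pair; apply/val_inj => /=; apply/eqP; rewrite -eqz_nat ?e1 ?e2.
(* The cell lies on the line through [u] and [v], so it is constant along the normal [d]; the sign
   of [d] is then chosen to favour [e]. *)
pose d : R * R := (- (v.2%:R - u.2%:R), v.1%:R - u.1%:R).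
have dE e' : dot e' d - dot u d = (triangle_det u v e')%:~R.
  by rewrite triangle_detE.
have [gt0|lt0|e0] := ltrgtP 0 (triangle_det u v e); last by rewrite e0 eqxx in ne.
- exists d, e; split=> //; first by rewrite -subr_gt0 dE ltr0z.
  by move=> e' /col h; apply/eqP; rewrite -subr_eq0 dE h.
- have dN e' : dot e' (- d.1, - d.2) = - dot e' d by rewrite /dot /=; ring.
  exists (- d.1, - d.2), e; split=> //; first by rewrite !dN ltrN2 -subr_lt0 dE ltrz0.
  by move=> e' /col h; rewrite !dN; congr (- _); apply/eqP; rewrite -subr_eq0 dE h.
Qed.

(** Enlargement is iterated, by induction on the number of exponents outside the cell. *)
Lemma full_dimensional_cell P : exists P',
  newton_cell V f P \subset newton_cell V f P' /\
  full_dimensional (newton_cell V f P').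
Proof.
have [k] := ubnP (#|{: 'I_5 * 'I_5}| - #|newton_cell V f P|)%N.
elim: k P => // k IH P ltk.
have [|nfd] := pselect (full_dimensional (newton_cell V f P)); first by exists P.
have [P' PP'] := newton_cell_grow nfd.
have [|P'' [s1 fd]] := IH P'.
  have lt_card : (#|newton_cell V f P| < #|newton_cell V f P'|)%N.
    by apply: fintype.proper_card.
   rewrite -ltnS; apply: leq_trans ltk; rewrite ltnS.
  by apply: ltn_sub2l => //; apply: leq_trans lt_card _; exact: max_card.
by exists P''; split=> //; apply: fintype.subset_trans s1; exact: fintype.proper_sub.
Qed.

End NewtonCells.

(** * Trinomials that are squares on the line X + Y + Z = 0, and enumeration of unimodular
    triangles *)

Section TrinomialSquares.
Variable R : realFieldType.

Definition mono (u : nat * nat * nat) (X Y Z : int) : R :=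
  X%:~R ^+ u.1.1 * Y%:~R ^+ u.1.2 * Z%:~R ^+ u.2.

(* [p], [r], [t] are the opposites of the values of a quadratic form at
   (0,1,-1), (1,0,-1) and (1,-1,0); they determine it on X + Y + Z = 0. *)
Definition no_square (T : (nat * nat * nat) * (nat * nat * nat) * (nat * nat * nat)) :=
  forall a b c k p r t : R, k != 0 -> 0 < p -> 0 < r -> 0 < t ->
  ~ forall X Y Z : int, X + Y + Z = 0 ->
    a * mono T.1.1 X Y Z + b * mono T.1.2 X Y Z + c * mono T.2 X Y Z =
    k * (p * (Y * Z)%:~R + r * (X * Z)%:~R + t * (X * Y)%:~R) ^+ 2.

(** Evaluating at a few integral points of the line and eliminating [a], [b], [c] leaves a relation
    contradicting [0 < t * r]. *)
Lemma no_square_A : no_square ((0, 0, 4), (1, 3, 0), (0, 1, 3))%N.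
Proof.
move=> a b c k p r t k0 p0 r0 t0 H.
have H1 := H 0 (-1) 1 erefl; have H2 := H (-1) 1 0 erefl.
have H3 := H (-2) 1 1 erefl; have H4 := H 0 1 (-1) erefl.
have H5 := H (-3) 2 1 erefl; have H6 := H 1 (-2) 1 erefl.
rewrite /mono /= in H1 H2 H3 H4 H5 H6.
have : k * ((r + t - p) ^+ 2 + 2 * t * r) = 0 by lra.
move/eqP; rewrite mulf_eq0 (negbTE k0) /= => /eqP h.
by have := sqr_ge0 (r + t - p); have := mulr_gt0 t0 r0; lra.
Qed.

(** The elimination leaves two relations: the first gives [p = r + t], and the second then reduces
    to [2 * t * r + t ^+ 2 = 0]. *)
Lemma no_square_B : no_square ((0, 0, 4), (1, 3, 0), (1, 2, 1))%N.
Proof.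
move=> a b c k p r t k0 p0 r0 t0 H.
have H1 := H 0 (-1) 1 erefl; have H2 := H (-1) 1 0 erefl.
have H3 := H (-2) 1 1 erefl; have H4 := H 0 1 (-1) erefl.
have H5 := H (-3) 2 1 erefl; have H6 := H 1 (-2) 1 erefl.
rewrite /mono /= in H1 H2 H3 H4 H5 H6.
have h1 : k * (r * (r + t - p)) = 0 by lra.
have h2 : k * ((r + t - p) ^+ 2 + 2 * t * r + t ^+ 2 - 2 * t * (r + t - p)) = 0.
  by lra.
move/eqP: h1; rewrite !mulf_eq0 (negbTE k0) gt_eqF//= => /eqP e0.
move/eqP: h2; rewrite e0 mulf_eq0 (negbTE k0) /= => /eqP.
by have := mulr_gt0 t0 r0; have := mulr_gt0 t0 t0; lra.
Qed.

Definition swap_xy (u : nat * nat * nat) := (u.1.2, u.1.1, u.2).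
Definition swap_yz (u : nat * nat * nat) := (u.1.1, u.2, u.1.2).
Definition swap_12 (T : (nat * nat * nat) * (nat * nat * nat) * (nat * nat * nat)) :=
  (T.1.2, T.1.1, T.2).
Definition swap_23 (T : (nat * nat * nat) * (nat * nat * nat) * (nat * nat * nat)) :=
  (T.1.1, T.2, T.1.2).
Definition map3 (g : nat * nat * nat -> nat * nat * nat)
  (T : (nat * nat * nat) * (nat * nat * nat) * (nat * nat * nat)) :=
  (g T.1.1, g T.1.2, g T.2).

Lemma no_square_swap_12 T : no_square T -> no_square (swap_12 T).
Proof.
move=> nT a b c k p r t k0 p0 r0 t0 H; apply: (nT b a c k p r t) => // X Y Z s.
by rewrite -H// /swap_12 /=; ring.
Qed.

Lemma no_square_swap_23 T : no_square T -> no_square (swap_23 T).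
Proof.
move=> nT a b c k p r t k0 p0 r0 t0 H; apply: (nT a c b k p r t) => // X Y Z s.
by rewrite -H// /swap_23 /=; ring.
Qed.

Lemma no_square_swap_xy T : no_square T -> no_square (map3 swap_xy T).
Proof.
move=> nT a b c k p r t k0 p0 r0 t0 H; apply: (nT a b c k r p t) => // X Y Z s.
have := H Y X Z; rewrite (addrC Y) => /(_ s) E.
rewrite (mulrC X Y) (addrC (r * _)) -E /mono /map3 /swap_xy /=.
by rewrite !(mulrC (Y%:~R ^+ _)).
Qed.

Lemma no_square_swap_yz T : no_square T -> no_square (map3 swap_yz T).
Proof.
move=> nT a b c k p r t k0 p0 r0 t0 H; apply: (nT a b c k p t r) => // X Y Z s.
have := H X Z Y; rewrite addrAC => /(_ s) E.
rewrite (mulrC Y Z) (addrAC _ (t * _)) -E /mono /map3 /swap_yz /=.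
by rewrite -!(mulrAC _ (Z%:~R ^+ _)).
Qed.

Definition with_images (A : Type) (g : A -> A) (s : seq A) := s ++ map g s.

Lemma with_images_ind (A : eqType) (P : A -> Prop) (g : A -> A) (s : seq A) :
  (forall x, P x -> P (g x)) -> (forall x, x \in s -> P x) ->
  forall x, x \in with_images g s -> P x.
Proof.
move=> Pg Ps x; rewrite mem_cat => /orP[/Ps//|/mapP[y /Ps Py ->]]; exact: Pg.
Qed.

(** For two adjacent transpositions [g] and [h], the words obtained this way exhaust the symmetric
    group on three letters. *)
Definition all_images g h (s : seq ((nat * nat * nat) * (nat * nat * nat) * (nat * nat * nat))) :=
  with_images g (with_images h (with_images g s)).

Definition square_candidates := all_images swap_12 swap_23
  (all_images (map3 swap_xy) (map3 swap_yz)
    [:: ((0, 0, 4), (1, 3, 0), (0, 1, 3)); ((0, 0, 4), (1, 3, 0), (1, 2, 1))]%N).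

Lemma no_square_candidates T : T \in square_candidates -> no_square T.
Proof.
have I1 := no_square_swap_12; have I2 := no_square_swap_23.
have I3 := no_square_swap_xy; have I4 := no_square_swap_yz.
move: T; do !apply: with_images_ind => //; move=> T; rewrite !inE => /orP[]/eqP->.
  exact: no_square_A.
exact: no_square_B.
Qed.

Definition lattice_points : seq (nat * nat) :=
  [seq (a, b) | a <- iota 0 5, b <- iota 0 (5 - a)].

(* [|det| = 1], free of subtractions. *)
Definition unimodular (u v w : nat * nat) : bool :=
  let d := (u.1 * v.2 + v.1 * w.2 + w.1 * u.2)%N in
  let d' := (u.2 * v.1 + v.2 * w.1 + w.2 * u.1)%N in
  (d == d'.+1) || (d' == d.+1).

(** Exponents of the monomial homogenized to degree 4; each of them vanishes on one side of the
    Newton polygon. *)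
Definition bary (e : nat * nat) : nat * nat * nat := (e.1, e.2, 4 - e.1 - e.2)%N.

(** Decided by running through all triples of the fifteen lattice points of the Newton polygon. *)
Lemma unimodular_touching_sides (u v w : nat * nat) :
  u \in lattice_points -> v \in lattice_points -> w \in lattice_points ->
  unimodular u v w ->
  has (fun e => (bary e).1.1 == 0) [:: u; v; w] ->
  has (fun e => (bary e).1.2 == 0) [:: u; v; w] ->
  has (fun e => (bary e).2 == 0) [:: u; v; w] ->
  (bary u, bary v, bary w) \in square_candidates.
Proof.
(* [if], unlike the strict [==>], prunes the computation. *)
have : all (fun u => all (fun v => all (fun w => if unimodular u v w then
  if has (fun e => (bary e).1.1 == 0%N) [:: u; v; w] then
  if has (fun e => (bary e).1.2 == 0%N) [:: u; v; w] then
  if has (fun e => (bary e).2 == 0%N) [:: u; v; w] then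
  (bary u, bary v, bary w) \in square_candidates else true else true else true else true)
  lattice_points) lattice_points) lattice_points by vm_compute.
move=> /allP h uL vL wL; have /allP/(_ _ vL)/allP/(_ _ wL) := h _ uL.
by move=> H un h0 h1 h2; move: H; rewrite un h0 h1 h2.
Qed.

(** Two distinct points realize the minimum of [g], as is necessary for the terms of lowest order to
    cancel. *)
Definition attained_twice (g : nat * nat -> nat) (s : seq (nat * nat)) : bool :=
  has (fun e => has (fun e' => [&& e != e', g e == g e'
    & all (fun e'' => g e <= g e'')%N s]) s) s.

Lemma not_attained_twice (g : nat * nat -> nat) (s : seq (nat * nat)) :
  s != [::] -> ~~ attained_twice g s ->
  exists2 e0, e0 \in s & forall e, e \in s -> e != e0 -> (g e0 < g e)%N.
Proof.
move=> s0 nt; have [e0 e0s le_e0] : exists2 e0, e0 \in s & all (fun e => g e0 <= g e)%N s.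
  elim: s s0 {nt} => [//|x s IH] _; have [->|/IH[e0 e0s le_e0]] := eqVneq s [::].
    by exists x; rewrite ?inE//= leqnn.
  have [le|lt] := leqP (g e0) (g x).
    by exists e0; rewrite ?inE ?e0s ?orbT//= le.
  exists x; rewrite ?inE ?eqxx//= leqnn; apply/allP => y /(allP le_e0).
  exact: leq_trans (ltnW lt).
exists e0 => // e es ne; rewrite ltn_neqAle (allP le_e0 _ es) andbT.
apply: contra nt => /eqP ge; apply/hasP; exists e0 => //.
by apply/hasP; exists e => //; rewrite eq_sym ne ge eqxx -ge.
Qed.

Definition unit_triangle (x : nat * nat) : seq (nat * nat) :=
  [:: x; (x.1.+1, x.2); (x.1, x.2.+1)].

(* The monomials of the trinomial with a non-zero coefficient are those selected
   by the mask [s]. *)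
Lemma unimodular_attained_twice (u v w : nat * nat) (s : 3.-tuple bool) :
  u \in lattice_points -> v \in lattice_points -> w \in lattice_points ->
  unimodular u v w -> has id s ->
  attained_twice (fun e => (bary e).1.1) (mask s [:: u; v; w]) ->
  attained_twice (fun e => (bary e).1.2) (mask s [:: u; v; w]) ->
  attained_twice (fun e => (bary e).2) (mask s [:: u; v; w]) ->
  all id s /\ exists2 x, (x.1 + x.2 <= 3)%N & perm_eq [:: u; v; w] (unit_triangle x).
Proof.
pose bools := [:: true; false].
pose masks := [seq b :: s | b <- bools, s <- [seq [:: b1; b2] | b1 <- bools, b2 <- bools]].
have : all (fun u => all (fun v => all (fun w => if unimodular u v w then
  all (fun s => if has id s then
  if attained_twice (fun e => (bary e).1.1) (mask s [:: u; v; w]) then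
  if attained_twice (fun e => (bary e).1.2) (mask s [:: u; v; w]) then
  if attained_twice (fun e => (bary e).2) (mask s [:: u; v; w]) then
  all id s && has (fun x => (x.1 + x.2 <= 3)%N && perm_eq [:: u; v; w] (unit_triangle x))
     lattice_points else true else true else true else true) masks else true)
  lattice_points) lattice_points) lattice_points by vm_compute.
move=> /allP h uL vL wL uni; have /allP/(_ _ vL)/allP/(_ _ wL) := h _ uL.
rewrite uni => /allP/(_ (val s)) H h0 h1 h2 h3.
have sm : val s \in masks.
  by case: s {H h0 h1 h2 h3} => -[|[] [|[] [|[] []]]].
move: (H sm); rewrite h0 h1 h2 h3 => /andP[-> /hasP[x _ /andP[]]].
by move=> x3 px; split=> //; exists x.
Qed.

End TrinomialSquares.

(** * Terms of lowest order on the line X + Y + 1 = 0 *)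

Section MinimalExponents.
Variable R : realFieldType.

Lemma poly_eq0_nat (p : {poly R}) : (forall k : nat, p.[k%:R] = 0) -> p = 0.
Proof.
move=> h; apply: (@roots_geq_poly_eq0 _ p [seq i%:R | i <- iota 0 (size p)]).
- by apply/allP => _ /mapP[i _ ->]; apply/rootP.
- by rewrite map_inj_uniq ?iota_uniq// => i j /eqP; rewrite eqr_nat => /eqP.
- by rewrite size_map size_iota.
Qed.

(** The sum is a polynomial vanishing at all naturals, hence zero. Its coefficient of degree [la e0]
    comes from [e0] alone and equals [rho e0] up to sign. *)
Lemma minimal_exponent_coef0 (I : finType) (rho : I -> R) (la mu : I -> nat) e0 :
  (forall k : nat, \sum_e rho e * k%:R ^+ la e * (- 1 - k%:R) ^+ mu e = 0) ->
  (forall e, rho e != 0 -> e != e0 -> (la e0 < la e)%N) -> rho e0 = 0.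
Proof.
move=> H0 Hmin.
pose p : {poly R} := \sum_e rho e *: ('X^(la e) * (- 1 - 'X) ^+ mu e).
have p0 : p = 0.
  apply: poly_eq0_nat => k; rewrite horner_sum -[RHS](H0 k); apply: eq_bigr => e _.
  by rewrite !hornerE.
have : p`_(la e0) = rho e0 * (-1) ^+ mu e0.
  rewrite coef_sum (bigD1 e0)//= big1 ?addr0 => [|e ne].
    by rewrite coefZ coefXnM ltnn subnn -horner_coef0 !hornerE subr0.
  rewrite coefZ coefXnM; have [->|re] := eqVneq (rho e) 0; first by rewrite mul0r.
  by rewrite Hmin// mulr0.
by rewrite p0 coef0 => /esym/eqP; rewrite mulf_eq0 signr_eq0 orbF => /eqP.
Qed.

End MinimalExponents.

(** * Determinants of unimodular lattice triangles *)

Section UnimodularTriangles.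
Implicit Types (u v w : 'I_5 * 'I_5) (T : {set 'I_5 * 'I_5}).

Lemma triangle_det_swap12 u v w : triangle_det v u w = - triangle_det u v w.
Proof. by rewrite /triangle_det; ring. Qed.

Lemma triangle_det_swap23 u v w : triangle_det u w v = - triangle_det u v w.
Proof. by rewrite /triangle_det; ring. Qed.

Lemma triangle_det_id12 u w : triangle_det u u w = 0.
Proof. by rewrite /triangle_det; ring. Qed.

Lemma triangle_det_id13 u v : triangle_det u v u = 0.
Proof. by rewrite /triangle_det; ring. Qed.

Lemma triangle_det_id23 u v : triangle_det u v v = 0.
Proof. by rewrite /triangle_det; ring. Qed.

(** Non-collinear points of [T] are its vertices in some order, and reordering changes the
    determinant only by a sign. *)
Lemma unimodular_triangleP T u v w : unimodular_triangle T ->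
  u \in T -> v \in T -> w \in T -> triangle_det u v w != 0 ->
  T = [set u; v; w]%SET /\ `|triangle_det u v w| = 1.
Proof.
move=> [u' [v' [w' [-> d1]]]] uT vT wT.
have D1 a b c := triangle_det_swap12 a b c; have D2 a b c := triangle_det_swap23 a b c.
have Z1 := triangle_det_id12; have Z2 := triangle_det_id13; have Z3 := triangle_det_id23.
have E (A B : {set 'I_5 * 'I_5}) : (forall x, (x \in A) = (x \in B)) -> A = B.
  by move=> h; apply/setP.
move: uT vT wT; rewrite !inE.
do 3![case/orP => [/orP[]|] /eqP->]; rewrite ?Z1 ?Z2 ?Z3 ?eqxx// => _; split;
  do ?[by []|by apply: E => x; rewrite !inE; do 3!case: (x == _)].
- by rewrite D2 normrN.
- by rewrite D1 normrN.
- by rewrite D2 D1 opprK.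
- by rewrite D1 D2 opprK.
- by rewrite D1 D2 D1 !normrN.
Qed.

Definition pt u : nat * nat := (nat_of_ord u.1, nat_of_ord u.2).

Lemma pt_inj : injective pt.
Proof. by move=> [a b] [a' b'] [/val_inj-> /val_inj->]. Qed.

Lemma pt_lattice u : (u.1 + u.2 <= 4)%N -> pt u \in lattice_points.
Proof.
move=> u4; apply/allpairsPdep; exists (u.1 : nat), (u.2 : nat).
by rewrite !mem_iota /=; split=> //; lia.
Qed.

Lemma unimodular_pt u v w : `|triangle_det u v w| = 1 ->
  unimodular (pt u) (pt v) (pt w).
Proof.
rewrite /triangle_det /unimodular /=.
case: u v w => [u1 u2] [v1 v2] [w1 w2] /=.
move: (nat_of_ord u1) (nat_of_ord u2) (nat_of_ord v1) (nat_of_ord v2) => a b c d.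
by move: (nat_of_ord w1) (nat_of_ord w2) => e f; nia.
Qed.

End UnimodularTriangles.

(** * Roots and leading terms of sums with integral coefficients *)

Section WeightedSums.
Variables (R : realType) (KR : rcfType) (V : valued_field R KR).
Local Notation O := (integral V).
Local Notation res := (residue V).
Local Notation rv := (rval V).
Variables (I : finType) (a : I -> KR) (la mu : I -> nat) (x : KR) (i : nat).
Hypothesis x0 : x != 0.

Definition weighted e : KR := a e * x ^+ la e / x ^+ i.

Lemma weighted_small e : (a e != 0 -> i%:R * rv x < rv (a e) + (la e)%:R * rv x) ->
  O (weighted e) /\ res (weighted e) = 0.
Proof.
move=> h; rewrite /weighted; have [->|a0] := eqVneq (a e) 0.
  by rewrite !mul0r residue0; split=> //; exact: integral0.
have w0 : a e * x ^+ la e / x ^+ i != 0 by rewrite !mulf_neq0 ?invr_eq0 ?expf_neq0.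
have wE : 0 < rv (a e * x ^+ la e / x ^+ i).
  rewrite !(rvalM, rvalV, rvalX) ?mulf_neq0 ?invr_eq0 ?expf_neq0//.
  by have := h a0; rewrite !mulr_natl; lra.
have ow : O (a e * x ^+ la e / x ^+ i) by rewrite integralE ltW ?orbT.
split=> //; apply/eqP/negPn; rewrite residue_neq0//.
by rewrite gt_eqF.
Qed.

Lemma weighted_id e : la e = i -> weighted e = a e.
Proof. by rewrite /weighted => ->; rewrite mulfK ?expf_neq0. Qed.

Lemma weighted_sum (F : I -> KR) :
  \sum_e weighted e * F e = (\sum_e a e * x ^+ la e * F e) / x ^+ i.
Proof. by rewrite mulr_suml; apply: eq_bigr => e _; rewrite /weighted mulrAC. Qed.

(* Modulo the maximal ideal, dividing by [x ^+ i] leaves the polynomial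
   [a y * T ^+ mu y + a z * T ^+ (mu y).+1], whose simple root [- a y / a z] is
   real; a change of sign around it survives in the real closed field. *)
Lemma binomial_root y z : la y = i -> la z = i -> mu z = (mu y).+1 ->
  vunit V (a y) -> vunit V (a z) ->
  (forall e, e != y -> e != z -> a e != 0 ->
     i%:R * rv x < rv (a e) + (la e)%:R * rv x) ->
  exists2 T, vunit V T & \sum_e a e * x ^+ la e * T ^+ mu e = 0.
Proof.
move=> ly lz muz uy uz small; pose y0 := - a y / a z.
have uy0 : vunit V y0 by rewrite vunitM ?vunitN ?vunitV.
have oy0 := vunit_integral uy0.
have zy : z != y by apply: contra_eqN muz => /eqP->; rewrite eq_sym gtn_eqF.
(* In the variable [t = T / y0] the expected root has residue 1, and the reduction of [g] is a
   nonzero constant times [t ^+ mu y * (1 - t)]. *)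
pose g : {poly KR} := \sum_e (weighted e * y0 ^+ mu e) *: 'X^(mu e).
have gE t : g.[t] = \sum_e weighted e * (y0 * t) ^+ mu e.
  rewrite horner_sum; apply: eq_bigr => e _.
  by rewrite hornerZ hornerXn -mulrA -exprMn.
have ow e : O (weighted e).
  have [->|ey] := eqVneq e y; first by rewrite weighted_id// vunit_integral.
  have [->|ez] := eqVneq e z; first by rewrite weighted_id// vunit_integral.
  exact: (weighted_small (small e ey ez)).1.
have og t : O t -> O g.[t].
  move=> ot; rewrite gE; apply: integral_sum => e _.
  by apply: integralM => //; apply: integralX; exact: integralM.
have res0 : res (a z) * res y0 = - res (a y).
  rewrite -residue_mul ?vunit_integral// -residueN ?vunit_integral//.
  by congr (residue V _); rewrite /y0 mulrC divfK// (vunit_neq0 uz).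
have resg t : O t ->
    res g.[t] = res (a y) * res y0 ^+ mu y * (res t ^+ mu y * (1 - res t)).
  move=> ot; rewrite gE residue_sum => [|e _]; last first.
    by apply: integralM => //; apply: integralX; exact: integralM.
  have oyt : O (y0 * t) by exact: integralM.
  rewrite (bigD1 y)//= (bigD1 z)//= big1 ?addr0 => [|e /andP[ey ez]]; last first.
    rewrite residue_mul ?(weighted_small (small e ey ez)).2 ?mul0r//.
    exact: integralX.
  have oX e := integralX (mu e) oyt.
  rewrite !weighted_id// residue_mul ?oX ?vunit_integral//.
  rewrite residue_mul ?oX ?vunit_integral// !residueX// residue_mul//.
  rewrite muz !exprMn !exprS.
  have -> : res (a z) * (res y0 * res y0 ^+ mu y * (res t * res t ^+ mu y)) =
    (res (a z) * res y0) * (res y0 ^+ mu y * (res t * res t ^+ mu y)) by ring.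
  by rewrite res0; ring.
have oh : O (2^-1) by apply/vunit_integral/vunitV/vunit_nat.
have o3h : O (3 / 2) by apply: integralM => //; exact: integral_nat.
have rh : res 2^-1 = 2^-1.
  have : res (2^-1 * 2) = 1 by rewrite mulVf ?pnatr_eq0// residue1.
  rewrite residue_mul ?residue_nat//; last exact: integral_nat.
  by move=> h; lra.
have r3h : res (3 / 2) = 3 / 2.
  by rewrite residue_mul// ?rh ?residue_nat//; exact: integral_nat.
(* The reduction changes sign between 1/2 and 3/2; a positive product would have a nonnegative
   residue. *)
have neg : g.[2^-1] * g.[3 / 2] <= 0.
  rewrite leNgt; apply/negP => /ltW/(residue_ge0 (integralM (og _ oh) (og _ o3h))).
  rewrite residue_mul ?og// !resg// rh r3h.
  set A := res (a y) * res y0 ^+ mu y.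
  have A0 : A != 0.
    case/vunitP: uy => _ /eqP ra; case/vunitP: uy0 => _ /eqP r0.
    by rewrite mulf_neq0 ?expf_neq0.
  have -> : A * (2^-1 ^+ mu y * (1 - 2^-1)) * (A * ((3 / 2) ^+ mu y * (1 - 3 / 2))) =
     - (A ^+ 2 * (2^-1 ^+ mu y * (3 / 2) ^+ mu y) / 4) by field.
  rewrite oppr_ge0 leNgt => /negP; apply.
  have A2 : 0 < A ^+ 2 by rewrite exprn_even_gt0.
  have h2 : 0 < 2^-1 ^+ mu y :> R by rewrite exprn_gt0 ?invr_gt0.
  have h3 : 0 < (3 / 2) ^+ mu y :> R by rewrite exprn_gt0 ?divr_gt0.
  by rewrite divr_gt0 // mulr_gt0 // mulr_gt0.
have le12 : 2^-1 <= 3 / 2 :> KR by lra.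
have [t tI /rootP gt] := polyrcf.poly_ivt le12 neg.
rewrite in_itv /= in tI; exists (y0 * t).
  apply: vunitM => //; apply: (@vunit_between _ _ _ 2^-1 t (3 / 2)) => //.
  exact/vunitV/vunit_nat.
have /eqP : (\sum_e a e * x ^+ la e * (y0 * t) ^+ mu e) / x ^+ i = 0.
  by rewrite -weighted_sum -gE.
by rewrite mulf_eq0 invr_eq0 expf_eq0 (negbTE x0) andbF orbF => /eqP.
Qed.

(* The two values of the sum, at [x] and at [0], differ by a unit; comparing
   their valuations forces [i = 1]. *)
Lemma end_valuation y z w k U0 Ux : 0 < rv x -> (forall e, O (a e)) ->
  y != z -> w != y -> w != z -> la y = i -> la z = i -> (la w).+1 = i ->
  a w = x ->
  res (a y) * (-1) ^+ mu y + res (a z) * (-1) ^+ mu z = 0 ->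
  (forall e, e != y -> e != z -> e != w -> a e != 0 ->
     i%:R * rv x < rv (a e) + (la e)%:R * rv x) ->
  vunit V U0 -> vunit V Ux ->
  \sum_e a e * x ^+ la e * (- 1 - x) ^+ mu e = k * Ux ^+ 2 ->
  \sum_e a e * 0 ^+ la e * (- 1) ^+ mu e = k * U0 ^+ 2 ->
  i = 1%N /\ rv k = rv x.
Proof.
move=> vx oa yz wy wz ly lz lw aw resyz small uU0 uUx sumx sum0.
have ox : O x by rewrite integralE (ltW vx) orbT.
have rx : res x = 0.
  by apply/eqP/negPn; rewrite residue_neq0// gt_eqF.
have o1 : O (-1) by rewrite integralN integral1.
have o1x : O (- 1 - x) by exact: integralB.
have r1x : res (- 1 - x) = -1.
  by rewrite residueB// rx subr0 residueN ?residue1// integral1.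
(* The missing power of [x] in the term of [w] is supplied by its coefficient [a w = x]. *)
have ww : weighted w = 1.
  by rewrite /weighted aw -lw -exprS divff ?expf_neq0.
have ow e : O (weighted e).
  have [->|ey] := eqVneq e y; first by rewrite weighted_id.
  have [->|ez] := eqVneq e z; first by rewrite weighted_id.
  have [->|ew] := eqVneq e w; first by rewrite ww integral1.
  exact: (weighted_small (small e ey ez ew)).1.
(* The terms of [y] and [z] cancel in the residue field and the small terms vanish, so only [w]
   survives. *)
have resS : res (\sum_e weighted e * (- 1 - x) ^+ mu e) = (-1) ^+ mu w.
  rewrite residue_sum => [|e _]; last by apply: integralM => //; exact: integralX.
  rewrite (bigD1 y)//= (bigD1 z) 1?eq_sym//= (bigD1 w) ?wy//= big1 ?addr0; last first.
    move=> e /andP[/andP[ey ez] ew].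
    rewrite residue_mul ?(weighted_small (small e ey ez ew)).2 ?mul0r//.
    exact: integralX.
  have oX e : O ((- 1 - x) ^+ mu e) by exact: integralX.
  rewrite ww mul1r !weighted_id// residue_mul ?oX// residue_mul ?oX// !residueX// r1x.
  by rewrite addrA resyz add0r.
have uS : vunit V (k * Ux ^+ 2 / x ^+ i).
  rewrite -sumx -weighted_sum; apply/vunitP; rewrite resS; split; last first.
    by apply/eqP; rewrite signr_eq0.
  apply: integral_sum => e _; apply: integralM => //; exact: integralX.
have k0 : k != 0.
  by apply: contraTneq uS => ->; rewrite !mul0r /vunit eqxx.
have kE : rv k = i%:R * rv x.
  case/andP: uS => _ /eqP; case/andP: (vunitX 2 uUx) => U20 /eqP U2.
  rewrite !(rvalM, rvalV, rvalX) ?mulf_neq0 ?invr_eq0 ?expf_neq0 ?(vunit_neq0 uUx)//.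
  case/andP: uUx => _ /eqP ->; rewrite mul0rn mulr_natl; lra.
suff i1 : i = 1%N by rewrite kE i1 mul1r.
(* If [i > 1], the terms with [la e = 0] are none of [y], [z], [w]; the sum at 0 divided by [x ^+ i]
   then has residue 0, although it equals the unit [k * U0 ^+ 2 / x ^+ i]. *)
case: (ltngtP i 1%N) => [|i2|//]; first by rewrite -lw.
exfalso; have uS0 : vunit V (k * U0 ^+ 2 / x ^+ i).
  case/andP: (vunitX 2 uU0) => U20 /eqP U2.
  rewrite /vunit !mulf_neq0 ?invr_eq0 ?expf_neq0 ?(vunit_neq0 uU0)//=.
  rewrite !(rvalM, rvalV, rvalX) ?mulf_neq0 ?invr_eq0 ?expf_neq0 ?(vunit_neq0 uU0)//.
  by case/andP: uU0 => _ /eqP ->; rewrite kE mulr_natl mul0rn; apply/eqP; lra.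
case/vunitP: uS0 => _; apply; rewrite -sum0.
have -> : (\sum_e a e * 0 ^+ la e * (-1) ^+ mu e) / x ^+ i =
    \sum_(e | la e == 0%N) weighted e * (-1) ^+ mu e.
  rewrite mulr_suml [RHS]big_mkcond; apply: eq_bigr => e _; rewrite /weighted.
  case: eqVneq => [->|le]; first by rewrite !expr0 !mulr1 mulrAC.
  by rewrite expr0n (negbTE le) mulr0 !mul0r.
have wsm e : la e == 0%N -> O (weighted e) /\ res (weighted e) = 0.
  move=> /eqP le; apply: weighted_small; apply: small.
  - by apply: contra_eqN le => /eqP->; rewrite ly -lw.
  - by apply: contra_eqN le => /eqP->; rewrite lz -lw.
  - by apply: contra_eqN le => /eqP->; rewrite -lt0n -ltnS lw.
rewrite residue_sum => [|e le]; last by apply: integralM => //; exact: integralX.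
by rewrite big1// => e /wsm[oe re]; rewrite residue_mul ?re ?mul0r//; exact: integralX.
Qed.

End WeightedSums.

(** * Evaluation of quartics and their restriction to lines *)

Section PlaneQuartics.

Lemma eval_quartic (A : comNzRingType) (g : {poly {poly A}}) (x y : A) :
  quartic g ->
  g.[x, y] = \sum_(e : 'I_5 * 'I_5) g`_e.1`_e.2 * x ^+ e.1 * y ^+ e.2.
Proof.
move=> qg; have c0 i j : (4 < i + j)%N -> g`_i`_j = 0.
  by move=> ij; apply/eqP; apply: contraTT ij => /qg; rewrite leqNgt.
have s1 : (size g <= 5)%N.
  apply/leq_sizeP => i i5; apply/polyP => j; rewrite coef0 c0//.
  by rewrite (leq_trans i5)// leq_addr.
have s2 (i : nat) : (size (g`_i)%R <= 5)%N.
  apply/leq_sizeP => j j5; rewrite c0//.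
  by rewrite (leq_trans j5)// leq_addl.
transitivity (\sum_(i < 5) \sum_(j < 5) g`_i`_j * x ^+ i * y ^+ j); last first.
  by rewrite pair_bigA.
rewrite (horner_coef_wide _ s1) horner_sum; apply: eq_bigr => i _.
rewrite -rmorphXn hornerM hornerC (horner_coef_wide _ (s2 i)) mulr_suml.
by apply: eq_bigr => j _; rewrite mulrAC.
Qed.

Lemma to_closureE (KR : rcfType) (q : {poly {poly KR}}) i j :
  (to_closure q)`_i`_j = real_complex KR q`_i`_j.
Proof. by rewrite /to_closure !coef_map. Qed.

Lemma quartic_to_closure (KR : rcfType) (q : {poly {poly KR}}) :
  quartic q -> quartic (to_closure q).
Proof.
by move=> qq i j; rewrite to_closureE fmorph_eq0; exact: qq.
Qed.

Lemma eval_to_closure (KR : rcfType) (q : {poly {poly KR}}) (x y : KR) :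
  quartic q ->
  (to_closure q).[real_complex KR x, real_complex KR y] =
  real_complex KR q.[x, y].
Proof.
move=> qq; rewrite !eval_quartic ?rmorph_sum//; last exact: quartic_to_closure.
by apply: eq_bigr => e _; rewrite to_closureE !rmorphM !rmorphXn.
Qed.

Lemma eval_to_closure_conj (KR : rcfType) (q : {poly {poly KR}}) (x y : KR[i]) :
  quartic q ->
  (to_closure q).[conjc x, conjc y] = conjc (to_closure q).[x, y].
Proof.
move=> /quartic_to_closure qq; rewrite !eval_quartic// rmorph_sum.
apply: eq_bigr => e _; rewrite to_closureE !rmorphM !rmorphXn.
by rewrite [X in _ = X * _ * _]conjc_real.
Qed.

Variable KR : rcfType.
Local Notation K := KR[i].
Implicit Types (f : {poly {poly K}}) (m n x : K).

Lemma eval_line m n (z : K * K) : (line m n).[z.1, z.2] = z.2 + m + n * z.1.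
Proof. by rewrite /line !hornerE. Qed.

Lemma on_line m n (z : K * K) :
  ((line m n).[z.1, z.2] == 0) = (z.2 == - m - n * z.1).
Proof. by rewrite eval_line -addrA addr_eq0 opprD. Qed.

Lemma restrict_lineMXaddC f (g : {poly K}) m n :
  restrict_line (f * 'X + g%:P) m n =
  restrict_line f m n * 'X + (g \Po (- m%:P - n *: 'X)).
Proof.
by rewrite /restrict_line rmorphD rmorphM /= map_polyX map_polyC hornerMXaddC.
Qed.

Lemma restrict_line0 m n : restrict_line 0 m n = 0.
Proof. by rewrite /restrict_line map_poly0 horner0. Qed.

Lemma horner_restrict_line f m n x :
  (restrict_line f m n).[x] = f.[x, - m - n * x].
Proof.
elim/poly_ind: f => [|f g IH]; first by rewrite restrict_line0 !horner0.
by rewrite restrict_lineMXaddC hornerMXaddC !hornerD !hornerM IH horner_comp !hornerE.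
Qed.

Lemma map_derivMXaddC f (g : {poly K}) :
  map_poly (@deriv K) (f * 'X + g%:P) = map_poly (@deriv K) f * 'X + (g^`())%:P.
Proof.
apply/polyP => i; rewrite coef_map_id0 ?deriv0// !coefD !coefMX !coefC.
by rewrite coef_map_id0 ?deriv0// derivD; congr (_ + _); case: eqP; rewrite ?deriv0.
Qed.

Lemma lineE m n : line m n = n%:P%:P * 'X + ('X + m%:P)%:P.
Proof. by rewrite /line polyCD addrC. Qed.

(** Chain rule along the line, where y has derivative [- n]. *)
Lemma deriv_restrict_line f m n :
  (restrict_line f m n)^`() =
  restrict_line f^`() m n - n *: restrict_line (map_poly (@deriv K) f) m n.
Proof.
elim/poly_ind: f => [|f g IH].
  by rewrite map_poly0 deriv0 !restrict_line0 deriv0 scaler0 subr0.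
rewrite map_derivMXaddC.
have -> : (f * 'X + g%:P)^`() = f^`() * 'X + 0%:P + f.
  by rewrite derivD derivM derivX mulr1 derivC addr0 addr0.
have rD h h' : restrict_line (h + h') m n = restrict_line h m n + restrict_line h' m n.
  by rewrite /restrict_line rmorphD hornerD.
rewrite (rD _ f) !restrict_lineMXaddC derivD derivM derivX mulr1 IH comp_poly0 addr0.
rewrite deriv_comp derivB derivN derivC derivZ derivX oppr0 sub0r.
rewrite mulrN -scalerAr mulr1 scalerDr mulrBl -scalerAl opprD !addrA.
by congr (_ - _); rewrite addrAC.
Qed.

(** The gradient of the line is [(n, 1)], so the Jacobian is the derivative of [f] along the
    line. *)
Lemma jac_det_line f m n (z : K * K) : z.2 = - m - n * z.1 ->
  (jac_det f (line m n)).[z.1, z.2] = (restrict_line f m n)^`().[z.1].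
Proof.
move=> zl; rewrite deriv_restrict_line hornerD hornerN hornerZ !horner_restrict_line -zl.
rewrite /jac_det.
have -> : map_poly (@deriv K) (line m n) = 1%:P.
  rewrite lineE map_derivMXaddC -[n%:P%:P]add0r -[0](mul0r 'X) map_derivMXaddC.
  by rewrite map_poly0 derivC mul0r addr0 mul0r add0r derivD derivX derivC addr0.
have -> : (line m n)^`() = n%:P%:P.
  by rewrite lineE derivD derivM derivX !derivC mul0r mulr1 add0r addr0.
by rewrite !hornerE mulrC.
Qed.

(* [K] is algebraically closed, so the multiplicities determine the polynomial. *)
Lemma bitangent_factor f m n (p p' : K * K) : bitangent_triple f m n p p' ->
  exists k : K, restrict_line f m n = k *: (('X - p.1%:P) * ('X - p'.1%:P)) ^+ 2.
Proof.
case=> _ r0 [/eqP lp /eqP lp'] mult; rewrite !on_line in lp lp'.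
have [r rE] := closed_field_poly_normal (restrict_line f m n).
have lc0 : lead_coef (restrict_line f m n) != 0 by rewrite lead_coef_eq0.
exists (lead_coef (restrict_line f m n)); rewrite [LHS]rE; congr (_ *: _).
suff pr : perm_eq r [:: p.1; p.1; p'.1; p'.1].
  by rewrite (perm_big _ pr) /= !big_cons big_nil; ring.
(* The occurrences of [x] are counted on both sides; in [r] their number is the multiplicity of the
   root [x]. *)
apply/allP => x _ /=; apply/eqP.
have := mult (x, - m - n * x); have := on_line m n (x, - m - n * x).
rewrite /= eqxx => /eqP lx /(_ lx); rewrite /line_mult /= {1}rE -mul_polyC mupMr ?rootC// mu_prod_XsubC => ->.
have E (u : K * K) : u.2 == - m - n * u.1 ->
    ((x, - m - n * x) == u) = (u.1 == x).
  case: u => u1 u2 /= /eqP->; rewrite xpair_eqE /= eq_sym.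
  by case: eqP => [->|]; rewrite ?eqxx.
by rewrite !E//; case: (p.1 == x); case: (p'.1 == x).
Qed.

End PlaneQuartics.

(** * Normalization of the line to X + Y + Z = 0 *)

Section Rescaling.
Variables (R : realType) (KR : rcfType) (V : valued_field R KR).
Variables (q : {poly {poly KR}}) (m n : KR).
Hypotheses (qq : quartic q) (m0 : m != 0) (n0 : n != 0).
Local Notation f := (to_closure q).
Local Notation rv := (rval V).
Implicit Types e : 'I_5 * 'I_5.

(** The point at which the tropical monomials of [y], [m] and [n x] coincide. *)
Definition vertex : R * R := (rv n - rv m, - rv m).

(* Coefficients after the substitution x = (m / n) X, y = m Y, which turns the
   line y + m + n x into X + Y + 1 and moves its tropical vertex to the origin. *)
Definition rescaled e : KR := q`_e.1`_e.2 * (m / n) ^+ e.1 * m ^+ e.2.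

Definition rescaled_form (X Y Z : KR) : KR :=
  \sum_e rescaled e * X ^+ e.1 * Y ^+ e.2 * Z ^+ (4 - e.1 - e.2).

Lemma in_support_rescaled e : in_support f e = (rescaled e != 0).
Proof.
rewrite /in_support to_closureE fmorph_eq0 /rescaled !(mulf_eq0, expf_eq0, invr_eq0).
by rewrite (negbTE m0) (negbTE n0) /= !andbF !orbF.
Qed.

Lemma rescaled_quartic e : rescaled e != 0 -> (e.1 + e.2 <= 4)%N.
Proof.
by move=> h; apply: qq; apply: contra_neq h; rewrite /rescaled => ->; rewrite !mul0r.
Qed.

(** Rescaling moves the vertex to the origin, so the cell dual to the vertex is read off from the
    valuations of the coefficients. *)
Lemma trop_monomial_rescaled e : rescaled e != 0 ->
  trop_monomial V f vertex e = - rv (rescaled e).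
Proof.
move=> h; have c0 : q`_e.1`_e.2 != 0.
  by apply: contra_neq h; rewrite /rescaled => ->; rewrite !mul0r.
have mn0 : m / n != 0 by rewrite mulf_neq0 ?invr_eq0.
rewrite /trop_monomial to_closureE trop_real// /rescaled.
rewrite !(rvalM V, rvalX V) ?mulf_neq0 ?expf_neq0 ?rvalV ?invr_eq0//.
by rewrite /vertex /=; ring.
Qed.

Lemma rescaled_formE X Y Z : Z != 0 ->
  rescaled_form X Y Z = q.[m / n * X / Z, m * Y / Z] * Z ^+ 4.
Proof.
move=> Z0; rewrite eval_quartic// mulr_suml; apply: eq_bigr => e _.
have [r0|/rescaled_quartic e4] := eqVneq (rescaled e) 0.
  have -> : q`_e.1`_e.2 = 0.
    by move/eqP: r0; rewrite !(mulf_eq0, expf_eq0, invr_eq0) (negbTE m0) (negbTE n0)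
      !andbF !orbF => /eqP.
  by rewrite r0 !mul0r.
have -> : Z ^+ 4 = Z ^+ e.1 * Z ^+ e.2 * Z ^+ (4 - e.1 - e.2).
  by rewrite -!exprD -subnDA subnKC.
rewrite /rescaled !exprMn !exprVn; field.
by rewrite !expf_neq0.
Qed.

Lemma tropV_rescaled X Y Z : X != 0 -> Y != 0 -> Z != 0 ->
  rescaled_form X Y Z = 0 ->
  [set trop_point V p | p in
    [set p : KR[i] * KR[i] | in_torus p /\ f.[p.1, p.2] = 0]]%classic
  (vertex.1 - rv X + rv Z, vertex.2 - rv Y + rv Z).
Proof.
move=> X0 Y0 Z0 /eqP; rewrite rescaled_formE// mulf_eq0 expf_eq0 (negbTE Z0) orbF => /eqP h.
exists (real_complex KR (m / n * X / Z), real_complex KR (m * Y / Z)).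
  split; first by split; rewrite fmorph_eq0 !mulf_neq0 ?invr_eq0.
  by rewrite /= eval_to_closure// h rmorph0.
rewrite /trop_point /= !trop_real ?mulf_neq0 ?invr_eq0//.
rewrite !(rvalM, rvalV) ?mulf_neq0 ?invr_eq0// /vertex /=.
by congr pair; ring.
Qed.

(* A pair of conjugate tangency points [a + ib], [a - ib] makes the form the
   square of a definite quadratic form on the line X + Y + Z = 0. *)
Lemma rescaled_form_square (k : KR[i]) (a b : KR) : b != 0 ->
  restrict_line f (real_complex KR m) (real_complex KR n) =
    k *: (('X - (Complex a b)%:P) * ('X - (conjc (Complex a b))%:P)) ^+ 2 ->
  exists k', forall X Y Z, X + Y + Z = 0 -> rescaled_form X Y Z =
    k' * (((a * n / m) ^+ 2 + (b * n / m) ^+ 2) * (Y * Z) +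
          ((1 + a * n / m) ^+ 2 + (b * n / m) ^+ 2) * (X * Z) + X * Y) ^+ 2.
Proof.
move=> b0 fE.
have E x : real_complex KR q.[x, - m - n * x] =
    k * real_complex KR (((x - a) ^+ 2 + b ^+ 2) ^+ 2).
  have := horner_restrict_line f (real_complex KR m) (real_complex KR n) (real_complex KR x).
  rewrite -rmorphM -rmorphN -rmorphB eval_to_closure// => <-; rewrite fE hornerZ horner_exp.
  rewrite hornerM !hornerXsubC; congr (_ * _); rewrite rmorphXn; congr (_ ^+ 2).
  by simpc; apply/eqP; rewrite eq_complex /=; apply/andP; split; apply/eqP; ring.
(* Evaluation at the real part [a] gives [k * b ^+ 4], which is real. *)
have [k1 kE] : exists k1, k = real_complex KR k1.
  exists (q.[a, - m - n * a] / b ^+ 4); rewrite rmorphM fmorphV /=.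
  have := E a; rewrite subrr expr0n add0r -exprM => ->.
  by rewrite mulfK// fmorph_eq0 expf_neq0.
have {}E x : q.[x, - m - n * x] = k1 * ((x - a) ^+ 2 + b ^+ 2) ^+ 2.
  by apply: (@complexI KR); rewrite E kE -rmorphM.
(* With [X ^+ 2 = - X * (Y + Z)] and [Z ^+ 2 = - Z * (X + Y)], the quadratic factor becomes minus a
   combination of YZ, XZ and XY; the square absorbs the sign. *)
pose k' := k1 * (m / n) ^+ 4; exists k'.
have nz X Y Z : X + Y + Z = 0 -> Z != 0 -> rescaled_form X Y Z =
    k' * (((a * n / m) ^+ 2 + (b * n / m) ^+ 2) * (Y * Z) +
          ((1 + a * n / m) ^+ 2 + (b * n / m) ^+ 2) * (X * Z) + X * Y) ^+ 2.
  move=> s Z0; have YE : Y = - X - Z by lra.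
  rewrite rescaled_formE//.
  have -> : m * Y / Z = - m - n * (m / n * X / Z) by rewrite YE; field; rewrite ?n0 ?Z0 ?m0.
  by rewrite E /k' YE; field; rewrite ?n0 ?Z0 ?m0.
(* The affine chart misses [Z = 0]. For fixed [X] the difference [P] of the two sides is a
   polynomial in Z vanishing at all positive naturals, hence also at 0. *)
move=> X Y Z s; have [Z0|] := eqVneq Z 0; last exact: nz.
have YE : Y = - X by lra.
rewrite {}Z0 {}YE {Y Z s}.
pose N := (a * n / m) ^+ 2 + (b * n / m) ^+ 2.
pose N1 := (1 + a * n / m) ^+ 2 + (b * n / m) ^+ 2.
pose P : {poly KR} := \sum_e (rescaled e * X ^+ e.1) *: ((- X%:P - 'X) ^+ e.2 * 'X^(4 - e.1 - e.2))
  - k' *: (N *: ((- X%:P - 'X) * 'X) + (N1 * X) *: 'X + X *: (- X%:P - 'X)) ^+ 2.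
have PE z : P.[z] = rescaled_form X (- X - z) z -
    k' * (N * ((- X - z) * z) + N1 * (X * z) + X * (- X - z)) ^+ 2.
  rewrite hornerD horner_sum hornerN hornerZ horner_exp; congr (_ - _ * _ ^+ 2).
    by apply: eq_bigr => e _; rewrite !hornerE.
  by rewrite !hornerE /=.
have PX0 : P * 'X = 0.
  apply: poly_eq0_nat => -[|i]; rewrite hornerM hornerX ?mulr0//.
  by rewrite PE nz ?subrr ?mul0r ?pnatr_eq0//; ring.
have P0 : P = 0 by move/eqP: PX0; rewrite mulf_eq0 polyX_eq0 orbF => /eqP.
by have := PE 0; rewrite P0 horner0 subr0 => /esym/eqP; rewrite subr_eq0 => /eqP.
Qed.

End Rescaling.

(** * Conjugate tangency points at the vertex: reduction of the quartic form *)

Section VertexCase.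
Variables (R : realType) (KR : rcfType) (V : valued_field R KR).
Variables (q : {poly {poly KR}}) (m n : KR).
Hypotheses (qq : quartic q) (m0 : m != 0) (n0 : n != 0).
Hypothesis smooth : trop_smooth V (to_closure q).
Local Notation f := (to_closure q).
Local Notation O := (integral V).
Local Notation res := (residue V).
Local Notation rv := (rval V).
Local Notation c := (vertex V m n).
Local Notation A := (rescaled q m n).
Implicit Types (e u v w y z : 'I_5 * 'I_5).

Lemma in_support_corners :
  [/\ in_support f (ord0, ord0), in_support f (ord4, ord0) & in_support f (ord0, ord4)].
Proof.
by case: smooth => h1 h2 h3 _; rewrite /in_support /= val_ord4; split.
Qed.

Lemma unimodular_cell P : exists u v w,
  [/\ newton_cell V f P \subset [set u; v; w]%SET, `|triangle_det u v w| = 1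
    & forall e, e \in [set u; v; w]%SET -> (e.1 + e.2 <= 4)%N].
Proof.
have [S00 S40 S04] := in_support_corners.
have [P' [sub fd]] := full_dimensional_cell V S00 S40 S04 P.
case: smooth => _ _ _ /(_ _ fd)[u [v [w [E d1]]]].
exists u, v, w; rewrite -E; split=> // e /newton_cellP[+ _].
rewrite (in_support_rescaled q m0 n0); exact: rescaled_quartic.
Qed.

Variable u0 : 'I_5 * 'I_5.
Hypothesis u0c : u0 \in newton_cell V f c.

(** Dividing by the coefficient of a dominant monomial makes every coefficient integral; the units
    among them are exactly those of the cell dual to the vertex. *)
Definition unit_coef e : KR := A e / A u0.
Local Notation a := unit_coef.

Lemma rescaled_u0 : A u0 != 0.
Proof. by have /newton_cellP[] := u0c; rewrite (in_support_rescaled q m0 n0). Qed.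

Lemma unit_coef_eq0 e : (a e == 0) = (A e == 0).
Proof. by rewrite /unit_coef mulf_eq0 invr_eq0 (negbTE rescaled_u0) orbF. Qed.

Lemma in_support_unit_coef e : in_support f e = (a e != 0).
Proof. by rewrite unit_coef_eq0 (in_support_rescaled q m0 n0). Qed.

Lemma trop_monomial_unit_coef e : a e != 0 ->
  trop_monomial V f c e = - rv (a e) - rv (A u0).
Proof.
rewrite unit_coef_eq0 => ae; rewrite trop_monomial_rescaled// /unit_coef.
by rewrite rvalM ?invr_eq0 ?rescaled_u0// rvalV ?rescaled_u0//; ring.
Qed.

Lemma unit_coef_quartic e : a e != 0 -> (e.1 + e.2 <= 4)%N.
Proof. by rewrite unit_coef_eq0; exact: rescaled_quartic. Qed.

Lemma unit_coef_u0 : a u0 = 1.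
Proof. by rewrite /unit_coef divff ?rescaled_u0. Qed.

Lemma newton_cell_unit_coef d t e :
  reflect (a e != 0 /\ forall e', a e' != 0 ->
             rv (a e) - t * dot e d <= rv (a e') - t * dot e' d)
          (e \in newton_cell V f (ray c d t)).
Proof.
apply: (iffP (newton_cellP _ _ _ _)); rewrite in_support_unit_coef.
  move=> [ae h]; split=> // e' ae'; have := h e'.
  rewrite in_support_unit_coef => /(_ ae').
  by rewrite !trop_monomial_ray !trop_monomial_unit_coef//; lra.
move=> [ae h]; split=> // e'; rewrite in_support_unit_coef => ae'.
have := h e' ae'.
by rewrite !trop_monomial_ray !trop_monomial_unit_coef//; lra.
Qed.

Lemma unit_coef_integral e : O (a e).
Proof.
rewrite integralE; case: eqVneq => //= ae.
have := u0c; rewrite -{1}(ray0 c (0, 0)) => /newton_cell_unit_coef[_ /(_ _ ae)].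
by rewrite !mul0r !subr0 unit_coef_u0 rval1.
Qed.

Lemma newton_cell_vunit e : (e \in newton_cell V f c) = vunit V (a e).
Proof.
rewrite -{1}(ray0 c (0, 0)) /vunit.
have [ae|ae] := eqVneq (a e) 0.
  by apply/newton_cell_unit_coef => -[]; rewrite ae eqxx.
have := unit_coef_integral e; rewrite integralE (negbTE ae) /= => re.
apply/newton_cell_unit_coef/eqP => [[_ /(_ u0)]|r0].
  rewrite unit_coef_u0 oner_neq0 rval1 => /(_ isT) h; lra.
split=> // e' ae'; have := unit_coef_integral e'.
by rewrite integralE (negbTE ae') /= r0 => h; lra.
Qed.

Definition residue_coef e : R := res (a e).
Local Notation rho := residue_coef.

Lemma residue_coef_neq0 e : (rho e != 0) = (e \in newton_cell V f c).
Proof.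
rewrite newton_cell_vunit; apply/idP/idP => [/eqP h|/vunitP[_ /eqP//]].
by apply/vunitP; split=> //; exact: unit_coef_integral.
Qed.

Variables (k N N1 : KR).
Hypotheses (uN : vunit V N) (uN1 : vunit V N1) (N0 : 0 <= N) (N10 : 0 <= N1).
Hypothesis square : forall X Y Z, X + Y + Z = 0 ->
  rescaled_form q m n X Y Z = k * (N * (Y * Z) + N1 * (X * Z) + X * Y) ^+ 2.

Definition scale : KR := k / A u0.

Lemma unit_form X Y Z : X + Y + Z = 0 ->
  \sum_e a e * (X ^+ e.1 * Y ^+ e.2 * Z ^+ (4 - e.1 - e.2)) =
  scale * (N * (Y * Z) + N1 * (X * Z) + X * Y) ^+ 2.
Proof.
move=> s; rewrite /scale mulrAC -square// mulr_suml; apply: eq_bigr => e _.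
by rewrite /unit_coef; ring.
Qed.

(** At [(1, -1, 0)] the quadratic form equals -1, so [scale] is a sum of integral terms. *)
Lemma scale_integral : O scale.
Proof.
have := @unit_form 1 (-1) 0; rewrite !mulr0 mul1r add0r add0r sqrrN expr1n mulr1.
rewrite addr0 subrr => /(_ erefl) <-; apply: integral_sum => e _.
apply: integralM; first exact: unit_coef_integral.
apply: integralM; last by apply: integralX; exact: integral0.
by apply: integralM; apply: integralX; rewrite ?integralN integral1.
Qed.

Lemma residue_form (X Y Z : int) : X + Y + Z = 0 ->
  \sum_e rho e * mono R (bary (pt e)) X Y Z =
  res scale * (res N * (Y * Z)%:~R + res N1 * (X * Z)%:~R + 1 * (X * Y)%:~R) ^+ 2.
Proof.
move=> s; have sK : X%:~R + Y%:~R + Z%:~R = 0 :> KR by rewrite -!intrD s.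
have oi := integral_int V; have oN := vunit_integral uN; have oN1 := vunit_integral uN1.
have oX (z : int) j : O (z%:~R ^+ j) by apply: integralX.
have := congr1 res (unit_form sK); rewrite residue_sum => [|e _]; last first.
  by rewrite integralM ?unit_coef_integral// !integralM.
rewrite -!intrM residue_mul ?scale_integral//; last first.
  by rewrite integralX// !integralD ?integralM.
rewrite residueX ?integralD ?integralM// !residue_add ?integralM ?integralD ?integralM//.
rewrite (residue_mul oN)// (residue_mul oN1)// !residue_int mul1r => <-.
apply: eq_bigr => e _.
rewrite residue_mul ?unit_coef_integral ?integralM//; congr (_ * _).
by rewrite !residue_mul ?integralM// !residueX// !residue_int.
Qed.

Lemma residue_gt0 x : vunit V x -> 0 <= x -> 0 < res x.
Proof.
move=> ux x0; rewrite lt_neqAle residue_ge0 ?vunit_integral// andbT eq_sym.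
by case/vunitP: ux => _ /eqP.
Qed.

(** * The residue trinomial of a unimodular triangle containing the dual cell *)

Section Triangle.
Variables u v w : 'I_5 * 'I_5.
Hypothesis cell_sub : newton_cell V f c \subset [set u; v; w]%SET.
Hypothesis det1 : `|triangle_det u v w| = 1.
Hypothesis uvw4 : forall e, e \in [set u; v; w]%SET -> (e.1 + e.2 <= 4)%N.

Lemma triangle_neq : [/\ u != v, u != w & v != w].
Proof.
split; apply: contra_eqN det1 => /eqP->.
- by rewrite triangle_det_id12 normr0.
- by rewrite triangle_det_id13 normr0.
- by rewrite triangle_det_id23 normr0.
Qed.

Lemma triangle_sum (F : 'I_5 * 'I_5 -> R) :
  \sum_e rho e * F e = rho u * F u + rho v * F v + rho w * F w.
Proof.
have [uv uw vw] := triangle_neq.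
rewrite (bigD1 u)//= (bigD1 v) 1?eq_sym//= (bigD1 w) 1?eq_sym ?uw 1?eq_sym//=.
rewrite big1 ?addr0 ?addrA// => e /andP[/andP[eu ev] ew].
suff /eqP-> : rho e == 0 by rewrite mul0r.
apply/negPn; rewrite residue_coef_neq0; apply/negP => /(fintype.subsetP cell_sub).
by rewrite !inE (negbTE eu) (negbTE ev) (negbTE ew).
Qed.

Lemma triangle_lattice :
  [/\ pt u \in lattice_points, pt v \in lattice_points & pt w \in lattice_points].
Proof. by split; apply: pt_lattice; apply: uvw4; rewrite !inE eqxx ?orbT. Qed.

(** If [g] were nonzero at all three vertices, the whole trinomial would vanish at the given point,
    where the square does not. *)
Lemma touching_side (g : nat * nat * nat -> nat) (X Y Z : int) : X + Y + Z = 0 ->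
  (forall e, g (bary (pt e)) != 0%N -> mono R (bary (pt e)) X Y Z = 0) ->
  res scale * (res N * (Y * Z)%:~R + res N1 * (X * Z)%:~R + 1 * (X * Y)%:~R) ^+ 2 != 0 ->
  has (fun x => g (bary x) == 0%N) [:: pt u; pt v; pt w].
Proof.
move=> s h; rewrite -(residue_form s) triangle_sum; apply: contraNT => /=.
rewrite !negb_or => /and4P[hu hv hw _].
by rewrite !h// !mulr0 !addr0.
Qed.

Lemma residue_scale0 : res scale = 0.
Proof.
apply/eqP/negPn/negP => s0; have [lu lv lw] := triangle_lattice.
have pN := residue_gt0 uN N0; have pN1 := residue_gt0 uN1 N10.
have nN := lt0r_neq0 pN; have nN1 := lt0r_neq0 pN1.
suff cand : (bary (pt u), bary (pt v), bary (pt w)) \in square_candidates.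
  apply: (no_square_candidates cand (a := rho u) (b := rho v) (c := rho w) s0 pN pN1 ltr01) => X Y Z s.
  by have := residue_form s; rewrite triangle_sum.
have mono0 (x : R) j : j != 0%N -> x * 0%:~R ^+ j = 0.
  by move=> j0; rewrite expr0n (negbTE j0) mulr0.
apply: unimodular_touching_sides => //; first exact: unimodular_pt.
(* At the three points with one zero coordinate the quadratic form is minus [res N], [res N1] and 1
   respectively. *)
- apply: (@touching_side (fun x => x.1.1) 0 (-1) 1) => // [e e0|].
    by rewrite /mono expr0n (negbTE e0) !mul0r.
  by rewrite !mul0r !mulr0 !addr0 mulf_neq0// expf_neq0// mulf_neq0 ?intr_eq0.
- apply: (@touching_side (fun x => x.1.2) (-1) 0 1) => // [e e0|].
    by rewrite /mono mono0// mul0r.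
  by rewrite !mul0r !mulr0 !addr0 add0r mulf_neq0// expf_neq0// mulf_neq0 ?intr_eq0.
- apply: (@touching_side (fun x => x.2) (-1) 1 0) => // [e e0|].
    by rewrite /mono mono0.
  by rewrite !mulr0 !add0r mulf_neq0 ?expf_neq0 ?mulf_neq0 ?intr_eq0 ?oner_neq0.
Qed.

(** The trinomial vanishes on the line because [scale] has residue 0. Parametrizing the line by one
    coordinate, a unique term of lowest order would have coefficient zero. *)
Lemma triangle_attained_twice (g : nat * nat -> nat)
    (la mu : 'I_5 * 'I_5 -> nat) (X Y Z : nat -> int) :
  (forall i, X i + Y i + Z i = 0) ->
  (forall i e, mono R (bary (pt e)) (X i) (Y i) (Z i) =
               i%:R ^+ la e * (- 1 - i%:R) ^+ mu e) ->
  (forall e, la e = g (pt e)) ->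
  attained_twice g (map pt [seq e <- [:: u; v; w] | rho e != 0]).
Proof.
move=> s monoE laE.
have u0uvw : u0 \in [:: u; v; w].
  by have := fintype.subsetP cell_sub _ u0c; rewrite !inE orbA.
have ru0 : rho u0 != 0 by rewrite residue_coef_neq0.
apply/negPn/negP => /not_attained_twice[|_ /mapP[e0 + ->] min_e0].
  apply/eqP => /(congr1 (fun l => pt u0 \in l)); rewrite in_nil => /negbT/negP; apply.
  by apply: map_f; rewrite mem_filter ru0.
rewrite mem_filter => /andP[re0 _]; case/eqP: re0.
apply: (minimal_exponent_coef0 (la := la) (mu := mu)) => [i|e re ne].
  have := residue_form (s i); rewrite residue_scale0 mul0r => h; rewrite -[RHS]h.
  apply: eq_bigr => e _.
  by rewrite monoE mulrA.
rewrite !laE; apply: min_e0; last by rewrite (inj_eq pt_inj).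
apply: map_f; rewrite mem_filter re /=; have := re; rewrite residue_coef_neq0.
by move/(fintype.subsetP cell_sub); rewrite !inE orbA.
Qed.

Lemma triangle_unit : newton_cell V f c = [set u; v; w]%SET /\
  exists2 x, (x.1 + x.2 <= 3)%N & perm_eq [:: pt u; pt v; pt w] (unit_triangle x).
Proof.
have [lu lv lw] := triangle_lattice.
have maskE : mask [tuple rho u != 0; rho v != 0; rho w != 0] [:: pt u; pt v; pt w] =
    map pt [seq e <- [:: u; v; w] | rho e != 0].
  by rewrite filter_mask map_mask.
have u0uvw : u0 \in [:: u; v; w].
  by have := fintype.subsetP cell_sub _ u0c; rewrite !inE orbA.
have ru0 : rho u0 != 0 by rewrite residue_coef_neq0.
have [||||] := @unimodular_attained_twice (pt u) (pt v) (pt w)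
    [tuple rho u != 0; rho v != 0; rho w != 0] lu lv lw (unimodular_pt det1).
- have /hasP : exists2 e, e \in [:: u; v; w] & rho e != 0 by exists u0.
  by rewrite /= => ->.
- rewrite maskE; apply: (@triangle_attained_twice _ (fun e => e.1) (fun e => e.2)
    (fun i => i%:Z) (fun i => - 1 - i%:Z) (fun=> 1)) => [i|i e|e] //; first by ring.
  by rewrite /mono /= expr1n mulr1 rmorphB rmorphN.
- rewrite maskE; apply: (@triangle_attained_twice _ (fun e => e.2) (fun e => e.1)
    (fun i => - 1 - i%:Z) (fun i => i%:Z) (fun=> 1)) => [i|i e|e] //; first by ring.
  by rewrite /mono /= expr1n mulr1 rmorphB rmorphN mulrC.
- rewrite maskE; apply: (@triangle_attained_twice _ (fun e => 4 - e.1 - e.2)%N (fun e => e.2)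
    (fun=> 1) (fun i => - 1 - i%:Z) (fun i => i%:Z)) => [i|i e|e] //; first by ring.
  by rewrite /mono /= expr1n mul1r rmorphB rmorphN mulrC.
move=> /= /and4P[ru rv rw _] ex; split=> //; apply/eqP; rewrite finset.eqEsubset cell_sub.
by apply/fintype.subsetP => e; rewrite -residue_coef_neq0 !inE => /orP[/orP[]|] /eqP->.
Qed.

End Triangle.

(** Removing the common monomial from the trinomial leaves a linear form vanishing on X + Y + Z = 0,
    so its three coefficients agree. *)
Lemma unit_triangle_cell : exists t0 t1 t2 i j,
  [/\ [/\ pt t0 = (i, j), pt t1 = (i.+1, j) & pt t2 = (i, j.+1)], (i + j <= 3)%N,
      newton_cell V f c = [set t0; t1; t2]%SET, full_dimensional (newton_cell V f c)
    & rho t0 = rho t1 /\ rho t0 = rho t2].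
Proof.
have [u [v [w [sub det1 uvw4]]]] := unimodular_cell c.
have [cE [[i j] /= ij px]] := triangle_unit sub det1 uvw4.
have T x : x \in unit_triangle (i, j) -> exists2 t, t \in [set u; v; w]%SET & pt t = x.
  rewrite -(perm_mem px) !inE => /or3P[]/eqP->; [exists u|exists v|exists w];
    by rewrite // !inE eqxx ?orbT.
have [t0 t0T p0] : exists2 t, t \in [set u; v; w]%SET & pt t = (i, j).
  by apply: T; rewrite !inE eqxx.
have [t1 t1T p1] : exists2 t, t \in [set u; v; w]%SET & pt t = (i.+1, j).
  by apply: T; rewrite !inE eqxx orbT.
have [t2 t2T p2] : exists2 t, t \in [set u; v; w]%SET & pt t = (i, j.+1).
  by apply: T; rewrite !inE eqxx !orbT.
have dt : triangle_det t0 t1 t2 = 1.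
  move: p0 p1 p2; rewrite /triangle_det /pt => -[-> ->] [-> ->] [-> ->].
  by rewrite (intS i) (intS j); ring.
have uT : unimodular_triangle [set u; v; w]%SET by exists u, v, w.
have dt0 : triangle_det t0 t1 t2 != 0 by rewrite dt.
have [TE _] := unimodular_triangleP uT t0T t1T t2T dt0.
exists t0, t1, t2, i, j; split=> //; first by rewrite cE.
  by exists t0, t1, t2; rewrite cE dt; split.
have sub' : newton_cell V f c \subset [set t0; t1; t2]%SET by rewrite cE TE.
have det' : `|triangle_det t0 t1 t2| = 1 by rewrite dt normr1.
have [s [b0 b1 b2]] : exists s, [/\ bary (pt t0) = (i, j, s.+1),
    bary (pt t1) = (i.+1, j, s) & bary (pt t2) = (i, j.+1, s)].
  have [s [e0 e1 e2]] : exists s, [/\ 4 - i - j = s.+1, 4 - i.+1 - j = s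
      & 4 - i - j.+1 = s]%N.
    by exists (3 - i - j)%N; move: ij; clear => ij; split; lia.
  by exists s; rewrite p0 p1 p2 /bary /= ?e0 ?e1 ?e2; split; rewrite ?e0 ?e1 ?e2.
have E (X Y Z : int) : X + Y + Z = 0 -> X != 0 -> Y != 0 -> Z != 0 ->
    rho t0 * Z%:~R + rho t1 * X%:~R + rho t2 * Y%:~R = 0.
  move=> XYZ X0 Y0 Z0; have := residue_form XYZ.
  rewrite (residue_scale0 sub det1 uvw4) mul0r (triangle_sum sub' det') b0 b1 b2.
  rewrite /mono /= !exprS => h; have : (rho t0 * Z%:~R + rho t1 * X%:~R + rho t2 * Y%:~R) *
     (X%:~R ^+ i * Y%:~R ^+ j * Z%:~R ^+ s) = 0 by rewrite -h; ring.
  move/eqP; rewrite mulf_eq0 => /orP[/eqP//|].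
  by rewrite !(mulf_eq0, expf_eq0, intr_eq0) (negbTE X0) (negbTE Y0) (negbTE Z0) !andbF.
(* Two independent points without zero coordinate, where the common monomial can be cancelled. *)
have := E 1 1 (-2) erefl isT isT isT; have := E 1 (-2) 1 erefl isT isT isT.
rewrite !mulr1z => h1 h2.
by split; lra.
Qed.


(** * The three edges of the star at the vertex *)

(* The end of direction [end_dir d] is the one along which the monomials of small
   [side_exp d] become dominant; [cross_exp d] is a complementary exponent. *)
Definition side_exp (d : 'I_3) e : nat :=
  nth 0%N [:: e.1 : nat; e.2 : nat; (4 - e.1 - e.2)%N] d.
Definition cross_exp (d : 'I_3) e : nat :=
  nth 0%N [:: e.2 : nat; e.1 : nat; e.2 : nat] d.
Definition side_point (d : 'I_3) (x T : KR) : KR * KR * KR :=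
  nth (x, T, 1) [:: (x, T, 1); (T, x, 1); (1, T, x)] d.
Local Notation la := side_exp.
Local Notation mu := cross_exp.

Lemma ord3P (P : 'I_3 -> Prop) : P 0 -> P 1 -> P 2%:R -> forall d, P d.
Proof.
move=> P0 P1 P2 [[|[|[|//]]] h].
- by rewrite (_ : Ordinal h = 0)//; exact: val_inj.
- by rewrite (_ : Ordinal h = 1)//; exact: val_inj.
- by rewrite (_ : Ordinal h = 2%:R)//; exact: val_inj.
Qed.

Lemma side_form d x T :
  \sum_e a e * x ^+ la d e * T ^+ mu d e =
  \sum_e a e * ((side_point d x T).1.1 ^+ e.1 * (side_point d x T).1.2 ^+ e.2
                * (side_point d x T).2 ^+ (4 - e.1 - e.2)).
Proof.
move: d; apply: ord3P; apply: eq_bigr => e _; rewrite /side_exp /cross_exp /=.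
- by rewrite expr1n mulr1 mulrA.
- by rewrite expr1n mulr1 mulrA mulrAC.
- by rewrite expr1n mul1r mulrA mulrAC.
Qed.

Lemma dot_end_dir d e : (e.1 + e.2 <= 4)%N ->
  dot e (end_dir R d) = (if d == 2%:R then 4 else 0) - (la d e)%:R.
Proof.
move=> e4; move: d; apply: ord3P; rewrite /dot /end_dir /side_exp /=; try by ring.
by rewrite -subnDA natrB// natrD; ring.
Qed.

(** [y] and [z] are consecutive lattice points on a parallel to a side, so the determinant is the
    lattice distance of [w] from that parallel. *)
Lemma side_det d y z w : (y.1 + y.2 <= 4)%N -> (z.1 + z.2 <= 4)%N ->
  (w.1 + w.2 <= 4)%N -> la d y = la d z -> mu d z = (mu d y).+1 ->
  `|triangle_det y z w| = `|(la d w)%:Z - (la d y)%:Z|.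
Proof.
rewrite /triangle_det /side_exp /cross_exp.
case: y z w => [y1 y2] [z1 z2] [w1 w2] /=.
move: (nat_of_ord y1) (nat_of_ord y2) (nat_of_ord z1) (nat_of_ord z2)
  (nat_of_ord w1) (nat_of_ord w2) => {y1 y2 z1 z2 w1 w2} y1 y2 z1 z2 w1 w2.
clear; move: d; apply: ord3P => /= y4 z4 w4.
- move=> -> ->; rewrite intS -[RHS]normrN; congr `|_|; ring.
- by move=> -> ->; rewrite intS; congr `|_|; ring.
- move=> e1 e2; have e3 : y1 = z1.+1 by lia.
  have -> : (4 - w1 - w2)%N%:Z = 4 - w1%:Z - w2%:Z by lia.
  have -> : (4 - y1 - y2)%N%:Z = 4 - y1%:Z - y2%:Z by lia.
  by rewrite e2 e3 !intS; congr `|_|; ring.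
Qed.

Lemma side_corner d : exists2 e, in_support f e & la d e = 0%N.
Proof.
have [S00 S40 _] := in_support_corners.
move: d; apply: ord3P; [exists (ord0, ord0)|exists (ord0, ord0)|exists (ord4, ord0)] => //.
by rewrite /side_exp /= val_ord4.
Qed.

(** Provides the smallness hypotheses of [binomial_root] and [end_valuation]. *)
Lemma unit_coef_off_cell d t y e : y \in newton_cell V f (ray c (end_dir R d) t) ->
  vunit V (a y) -> e \notin newton_cell V f (ray c (end_dir R d) t) -> a e != 0 ->
  (la d y)%:R * t < rv (a e) + (la d e)%:R * t.
Proof.
move=> /newton_cell_unit_coef[ay hy] /andP[_ /eqP ry] ne ae.
rewrite ltNge; apply: contra ne => le; apply/newton_cell_unit_coef; split=> // e' ae'.
apply: le_trans (hy e' ae'); rewrite ry.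
rewrite !dot_end_dir ?unit_coef_quartic//.
by move: le; rewrite !mulrBr !(mulrC t) => le; lra.
Qed.

Lemma ray_continuous (P d : R * R) (s : R) :
  (ray P d s' @[s' --> s] --> ray P d s)%classic.
Proof.
rewrite /ray.
apply: (@cvg_pair _ _ _ (nbhs s) (nbhs (P.1 + s * d.1)) (nbhs (P.2 + s * d.2))) => /=;
  by apply: cvgD; [exact: cvg_cst|apply: cvgM; [exact: cvg_id|exact: cvg_cst]].
Qed.

Lemma side_point_ray d x T : rv T = 0 -> ray c (end_dir R d) (rv x) =
  (c.1 - rv (side_point d x T).1.1 + rv (side_point d x T).2,
   c.2 - rv (side_point d x T).1.2 + rv (side_point d x T).2).
Proof.
move=> rT; move: d; apply: ord3P; rewrite /ray /end_dir /side_point /= rT ?rval1;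
  by congr pair; ring.
Qed.

(** Points at distance [rv x] along the end lift to the curve by [binomial_root]; such distances are
    dense and [tropV] is closed. *)
Lemma edge_tropV d y z L : y != z -> vunit V (a y) -> vunit V (a z) ->
  la d y = la d z -> mu d z = (mu d y).+1 ->
  (forall s, 0 < s < L -> newton_cell V f (ray c (end_dir R d) s) = [set y; z]%SET) ->
  forall s, 0 < s < L -> tropV V f (ray c (end_dir R d) s).
Proof.
move=> yz uy uz lyz muz cellE s /andP[s0 sL] B nB.
have /nbhs_ballP[eps /= eps0 sub] := ray_continuous nB.
(* The bound [L] keeps the approximating point inside the edge, where the cell is known. *)
have s_min : s < Num.min (s + eps) L by rewrite lt_min sL ltrDl eps0.
have [x x0 /andP[sx]] := rval_dense V s_min; rewrite lt_min => /andP[xe xL].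
have rx : 0 < rv x < L by rewrite xL (lt_trans s0).
have [|T uT] := binomial_root x0 (erefl _) (esym lyz) muz uy uz _.
  move=> e ey ez ae; apply: unit_coef_off_cell => //.
    by rewrite cellE// !inE eqxx.
  by rewrite cellE// !inE negb_or ey ez.
rewrite side_form => form0; have T0 := vunit_neq0 uT.
exists (ray c (end_dir R d) (rv x)); split; last first.
  by apply: sub; rewrite /ball /= ltr_norml; lra.
have rT : rv T = 0 by case/andP: uT => _ /eqP.
rewrite (side_point_ray d x rT).
have [X0 Y0 Z0] : [/\ (side_point d x T).1.1 != 0, (side_point d x T).1.2 != 0
    & (side_point d x T).2 != 0].
  by move: d {lyz muz cellE nB sub form0}; apply: ord3P; split; rewrite // ?oner_neq0.
apply: tropV_rescaled => //.
apply: (mulIf (x := (A u0)^-1)); first by rewrite invr_eq0 rescaled_u0.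
rewrite mul0r -[RHS]form0 mulr_suml; apply: eq_bigr => e _.
by rewrite /unit_coef; ring.
Qed.

Lemma not_full_dimensional2 y z : ~ full_dimensional [set y; z]%SET.
Proof.
move=> [u [v [w []]]]; rewrite !inE.
by do 3![case/orP => /eqP->]; rewrite ?triangle_det_id12 ?triangle_det_id13
  ?triangle_det_id23 ?eqxx.
Qed.

(** Along the end, the cell is the segment from [y] to [z] until a monomial [w] joins at distance
    [L]. Then [rv (a w) = L], and [end_valuation] at [x = a w] gives [i = 1] and [L = rv scale]. *)
Lemma end_edge d y z o i :
  newton_cell V f c = [set y; z; o]%SET -> full_dimensional (newton_cell V f c) ->
  la d y = i -> la d z = i -> la d o = i.+1 -> mu d z = (mu d y).+1 ->
  rho y = rho z -> (0 < i)%N ->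
  [/\ bounded_edge V f c (end_dir R d) (rv scale), i = 1%N & 0 < rv scale].
Proof.
move=> cellE fd ly lz lo muz ryz i0.
have yc : y \in newton_cell V f c by rewrite cellE !inE eqxx.
have zc : z \in newton_cell V f c by rewrite cellE !inE eqxx orbT.
have uy : vunit V (a y) by rewrite -newton_cell_vunit.
have uz : vunit V (a z) by rewrite -newton_cell_vunit.
have q4 P e : e \in newton_cell V f P -> (e.1 + e.2 <= 4)%N.
  by case/newton_cellP; rewrite in_support_unit_coef => /unit_coef_quartic.
have yz : y != z by apply: contra_eqN muz => /eqP->; rewrite ltn_eqF.
have dle e : e \in newton_cell V f c -> dot e (end_dir R d) <= dot y (end_dir R d).
  move=> ec; rewrite !dot_end_dir ?(q4 c)// lerD2l lerN2 ler_nat ly.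
  by move: ec; rewrite cellE !inE => /orP[/orP[]|] /eqP->; rewrite ?ly ?lz ?lo.
(* Since [0 < i], a corner on the side is steeper than [y], so the edge is bounded. *)
have [e0 Se0 le0] := side_corner d.
have lt_e0 : dot y (end_dir R d) < dot e0 (end_dir R d).
  have e04 : (e0.1 + e0.2 <= 4)%N.
    by apply: unit_coef_quartic; rewrite -in_support_unit_coef.
  by rewrite (dot_end_dir d e04) (dot_end_dir d (q4 _ _ yc)) ltrD2l ltrN2 ltr_nat ly le0.
have [L [L0 inner outer [w wL lt_w]]] := newton_cell_along_ray yc dle Se0 lt_e0.
have yL := outer y yc erefl.
have zL : z \in newton_cell V f (ray c (end_dir R d) L).
  by apply: outer => //; rewrite !dot_end_dir ?(q4 c)// ly lz.
have y4 := q4 _ _ yc; have z4 := q4 _ _ zc; have w4 := q4 _ _ wL.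
have lw : (la d w < i)%N.
  by move: lt_w; rewrite !dot_end_dir// ltrD2l ltrN2 ltr_nat ly.
have detE : `|triangle_det y z w| = `|(la d w)%:Z - i%:Z|.
  by rewrite (side_det y4 z4 w4 _ muz) ?ly ?lz.
have det0 : triangle_det y z w != 0.
  by rewrite -normr_eq0 detE; move: lw; clear; lia.
have fdL : full_dimensional (newton_cell V f (ray c (end_dir R d) L)).
  by exists y, z, w; split.
(* Unimodularity at the far endpoint puts [w] exactly one lattice step beyond the segment. *)
have [_ _ _ /(_ _ fdL) uni] := smooth.
have [cellL] := unimodular_triangleP uni yL zL wL det0.
rewrite detE => lwi; have {}lw : (la d w).+1 = i by move: lw lwi; clear; lia.
have aw : a w != 0 by case/newton_cell_unit_coef: wL.
have ry : rv (a y) = 0 by case/andP: uy => _ /eqP.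
have succ_lw : (la d w).+1%:R = (la d w)%:R + 1 :> R by rewrite natr1.
have LE : rv (a w) = L.
  have [_ /(_ y (vunit_neq0 uy))] := newton_cell_unit_coef _ _ _ wL.
  have [_ /(_ w aw)] := newton_cell_unit_coef _ _ _ yL.
  rewrite ry !dot_end_dir// ly -lw succ_lw.
  by rewrite !mulrBr mulrDr => h1 h2; lra.
have wy : w != y by apply: contra_eqN lw => /eqP->; rewrite ly gtn_eqF.
have wz : w != z by apply: contra_eqN lw => /eqP->; rewrite lz gtn_eqF.
have oy : o != y by apply: contra_eqN lo => /eqP->; rewrite ly ltn_eqF.
have small e : e != y -> e != z -> e != w -> a e != 0 ->
    i%:R * rv (a w) < rv (a e) + (la d e)%:R * rv (a w).
  move=> ey ez ew ae; rewrite LE -ly; apply: unit_coef_off_cell => //.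
  by rewrite cellL !inE !negb_or ey ez ew.
have aint := unit_coef_integral.
have ox : O (a w) := aint w.
have rx : res (a w) = 0.
  by apply/eqP/negPn; rewrite residue_neq0// LE gt_eqF.
have oN := vunit_integral uN; have oN1 := vunit_integral uN1.
(* The quadratic form at a point of the line close to one of its coordinate points; its residue
   there is minus that of [N], [N1] or 1. *)
pose U (x : KR) := N * ((side_point d x (- 1 - x)).1.2 * (side_point d x (- 1 - x)).2)
  + N1 * ((side_point d x (- 1 - x)).1.1 * (side_point d x (- 1 - x)).2)
  + (side_point d x (- 1 - x)).1.1 * (side_point d x (- 1 - x)).1.2.
have side_sum (x : KR) : (side_point d x (- 1 - x)).1.1
    + (side_point d x (- 1 - x)).1.2 + (side_point d x (- 1 - x)).2 = 0.
  by clear; move: d; apply: ord3P; rewrite /side_point /=; ring.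
have formU x : \sum_e a e * x ^+ la d e * (- 1 - x) ^+ mu d e = scale * U x ^+ 2.
  by rewrite side_form unit_form.
have unitB (x s t : KR) : O x -> res x = 0 -> O s -> vunit V t -> vunit V (x * s - t).
  move=> oxx rxx os /vunitP[ot rt]; apply/vunitP.
  rewrite residueB ?integralM// residue_mul// rxx mul0r sub0r.
  by split; [rewrite integralB ?integralM|move/eqP; rewrite oppr_eq0 => /eqP].
have uU x : O x -> res x = 0 -> vunit V (U x).
  have o1 := integral1 V; have u1 : vunit V 1 by rewrite /vunit oner_neq0 rval1 eqxx.
  move=> oxx rxx; rewrite /U; clear - uN uN1 oN oN1 o1 u1 oxx rxx unitB.
  move: d; apply: ord3P; rewrite /side_point /=.
  - rewrite (_ : _ + _ = x * (N1 - N - 1 - x) - N); last by ring.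
    by apply: unitB; rewrite // !integralB.
  - rewrite (_ : _ + _ = x * (N - N1 - 1 - x) - N1); last by ring.
    by apply: unitB; rewrite // !integralB.
  - rewrite (_ : _ + _ = x * (N1 - N * (1 + x) - 1) - 1); last by ring.
    by apply: unitB; rewrite // !integralB// integralM// integralD.
have r0 := residue0 V; have o0 := integral0 V.
have sumx := formU (a w); have := formU 0; rewrite subr0 => sum0.
have rhoyz : res (a y) * (-1) ^+ mu d y + res (a z) * (-1) ^+ mu d z = 0.
  rewrite -/(rho y) -/(rho z) ryz muz exprS; ring.
have vx : 0 < rv (a w) by rewrite LE.
have [i1 scaleE] := end_valuation aw vx aint yz wy wz ly lz lw erefl rhoyz small
  (uU 0 o0 r0) (uU _ ox rx) sumx sum0.
rewrite scaleE LE; split=> //; split=> // s sL.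
have cellE' s' : 0 < s' < L ->
    newton_cell V f (ray c (end_dir R d) s') = [set y; z]%SET.
  move=> /inner ->; apply/setP => e; rewrite finset.inE [in RHS]finset.inE.
  rewrite !finset.in_set1 cellE 2!finset.in_setU !finset.in_set1.
  have [->|ey] := eqVneq e y; first by rewrite eqxx.
  have [->|ez] := eqVneq e z; first by rewrite !dot_end_dir// ly lz eqxx.
  have [->|//] := eqVneq e o; rewrite !dot_end_dir ?(q4 c)//; last first.
    by rewrite cellE !inE eqxx !orbT.
  by rewrite (inj_eq (addrI _)) eqr_opp eqr_nat lo ly gtn_eqF.
split; first by apply: (@edge_tropV d y z L) => //; rewrite ly lz.
by rewrite /dual_vertex cellE'//; exact: not_full_dimensional2.
Qed.

Lemma vertex_contradiction : star_generic V f -> False.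
Proof.
move=> star; have [t0 [t1 [t2 [i [j [[p0 p1 p2] ij cellE fd [r1 r2]]]]]]] := unit_triangle_cell.
case: p0 => p01 p02; case: p1 => p11 p12; case: p2 => p21 p22.
(* Each end is dual to one side of the unit triangle; the third vertex lies one step further in. *)
have E0 := @end_edge 0 t0 t2 t1 i; have E1 := @end_edge 1 t0 t1 t2 j.
have E2 := @end_edge 2%:R t1 t2 t0 (3 - i - j).
rewrite /side_exp /cross_exp /= p01 p02 p11 p12 p21 p22 in E0 E1 E2.
have c1 : newton_cell V f c = [set t0; t2; t1]%SET by rewrite cellE finset.setUAC.
have c2 : newton_cell V f c = [set t1; t2; t0]%SET by rewrite cellE -finset.setUA finset.setUC.
have {}E0 := E0 c1 fd erefl erefl erefl erefl r2.
have {}E1 := E1 cellE fd erefl erefl erefl erefl r1.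
have e1 : (4 - i.+1 - j = 3 - i - j)%N by move: ij; clear; lia.
have e2 : (4 - i - j.+1 = 3 - i - j)%N by move: ij; clear; lia.
have e3 : (4 - i - j = (3 - i - j).+1)%N by move: ij; clear; lia.
have {}E2 := E2 c2 fd e1 e2 e3 erefl (etrans (esym r1) r2).
(* The exponents [i], [j] and [3 - i - j] add up to 3, and each positive one equals 1, so all are 1
   and all three ends carry bounded edges. *)
have i1 : i = 1%N.
  have j1 : (j <= 1)%N by case: (posnP j) => [->//|/E1[_ ->]].
  have k1 : (3 - i - j <= 1)%N by case: (posnP (3 - i - j)) => [->//|/E2[_ ->]].
  by have /E0[] : (0 < i)%N by move: ij j1 k1; clear; lia.
have j1 : j = 1%N.
  have k1 : (3 - i - j <= 1)%N by case: (posnP (3 - i - j)) => [->//|/E2[_ ->]].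
  by have /E1[] : (0 < j)%N by move: ij i1 k1; clear; lia.
rewrite i1 j1 in E0 E1 E2.
have [B0 _ _] := E0 isT; have [B1 _ _] := E1 isT; have [B2 _ _] := E2 isT.
(* The three lengths coincide, so the edge [d + 1] refutes the strict minimality of [d]. *)
have [|d /(_ (d + 1))] := star c (fun=> rv scale); first by apply: ord3P.
rewrite ltxx => h; suff /h : d + 1 != d by [].
by clear; move: d; apply: ord3P.
Qed.

End VertexCase.

(** * Complex conjugation of tangency points *)

Section ConjugateTangencies.
Variables (KR : rcfType) (q : {poly {poly KR}}) (m n : KR).
Hypothesis qq : quartic q.
Local Notation f := (to_closure q).
Local Notation rc := (real_complex KR).
Implicit Types p : KR[i] * KR[i].

Lemma in_baseP (z : KR[i]) : in_base z <-> conjc z = z.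
Proof.
case: z => a b; split=> [[x ->]|/= [/eqP]]; first by rewrite conjc_real.
by rewrite eq_sym -addr_eq0 -mulr2n mulrn_eq0 /= => /eqP->; exists a.
Qed.

Lemma bitangent_triple_on_line g (m' n' : KR[i]) p p' :
  bitangent_triple g m' n' p p' -> p.2 = - m' - n' * p.1.
Proof. by case=> _ _ [/eqP + _] _; rewrite on_line => /eqP. Qed.

Lemma bitangent_tripleC g (m' n' : KR[i]) p p' :
  bitangent_triple g m' n' p p' -> bitangent_triple g m' n' p' p.
Proof. by case=> h1 h2 [h3 h4] h5; split=> // z /h5 ->; rewrite addnC. Qed.

(** The restriction to the line has a double root at [p.1], so its derivative, which is the
    Jacobian, vanishes there. *)
Lemma local_tangency_triple g (m' n' : KR[i]) p p' :
  bitangent_triple g m' n' p p' -> local_tangency g m' n' p.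
Proof.
move=> tr; have pl := bitangent_triple_on_line tr.
have [k] := bitangent_factor tr; set Q := _ * _ => E.
have Q0 : Q.[p.1] = 0 by rewrite hornerM !hornerXsubC subrr mul0r.
case: tr => _ _ [lp _] _; split=> //.
  by rewrite pl -horner_restrict_line E hornerZ horner_exp Q0 expr0n mulr0.
rewrite jac_det_line// E derivZ expr2 derivM hornerZ hornerD !(hornerM Q, hornerM _ Q) Q0.
by rewrite !mul0r !mulr0 addr0 mulr0.
Qed.

(** The conjugate of [p] also lies on the real line and the real quartic, so it is [p] or [p']; the
    former would make [p.1] real. *)
Lemma conjugate_tangency p p' : bitangent_triple f (rc m) (rc n) p p' ->
  ~ in_base p.1 -> p' = (conjc p.1, conjc p.2).
Proof.
move=> tr nb; have [fp _ _] := local_tangency_triple tr.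
have pl := bitangent_triple_on_line tr.
have pl' : conjc p.2 = - rc m - rc n * conjc p.1.
  by rewrite pl !(rmorphB, rmorphN, rmorphM) /= !oppr0.
have on : (line (rc m) (rc n)).[conjc p.1, conjc p.2] = 0.
  by apply/eqP; rewrite (on_line _ _ (_, _)) /= pl'.
case: tr => _ r0 _ /(_ (conjc p.1, conjc p.2) on) mult.
have : (0 < line_mult f (rc m) (rc n) (conjc p.1, conjc p.2))%N.
  rewrite /line_mult -XsubC_dvd// dvdp_XsubCl; apply/rootP => /=.
  by rewrite horner_restrict_line -pl' eval_to_closure_conj// fp conjc0.
rewrite mult; case: eqP => [E|_]; last by case: eqP => [->|].
by case: nb; apply/in_baseP; rewrite -[RHS](congr1 fst E).
Qed.

Lemma trop_conj (R : realType) (V : valued_field R KR) (z : KR[i]) :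
  trop V (conjc z) = trop V z.
Proof. by case: z => a b; rewrite /trop /= sqrrN. Qed.

End ConjugateTangencies.

(** * The vertex of the tropicalized line *)

Section TropicalLineVertex.
Variables (R : realType) (KR : rcfType) (V : valued_field R KR) (m n : KR).
Hypotheses (m0 : m != 0) (n0 : n != 0).
Local Notation rc := (real_complex KR).
Local Notation rv := (rval V).

Lemma line_trop_point (X Y Z : KR) : X + Y + Z = 0 ->
  X != 0 -> Y != 0 -> Z != 0 -> tropV V (line (rc m) (rc n))
    ((vertex V m n).1 - rv X + rv Z, (vertex V m n).2 - rv Y + rv Z).
Proof.
move=> s X0 Y0 Z0; apply: subset_closure.
exists (rc (m / n * X / Z), rc (m * Y / Z)).
  split; first by split; rewrite fmorph_eq0 !mulf_neq0 ?invr_eq0.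
  rewrite (eval_line _ _ (_, _)) /= -rmorphM -!rmorphD.
  have -> : m * Y / Z + m + n * (m / n * X / Z) = m * (X + Y + Z) / Z.
    by field; rewrite ?n0 ?Z0.
  by rewrite s mulr0 mul0r rmorph0.
rewrite /trop_point /= !trop_real ?mulf_neq0 ?invr_eq0//.
rewrite !(rvalM V, rvalV V) ?mulf_neq0 ?invr_eq0// /vertex /=.
by congr pair; ring.
Qed.

Lemma trop_lineP (c P : R * R) : trop_line c P ->
  [\/ P.1 <= c.1 /\ P.2 = c.2, P.1 = c.1 /\ P.2 <= c.2
    | 0 <= P.1 - c.1 /\ P.1 - c.1 = P.2 - c.2].
Proof.
case=> [->|[d _ [s s0 ->]]]; first by constructor 1.
move: d; apply: ord3P; rewrite /ray /end_dir /=;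
  [constructor 1|constructor 2|constructor 3]; split; lra.
Qed.

(** Three points of the line tropicalize to [vertex] and to points strictly to its left and strictly
    below it; only a tropical line with that vertex contains all three. *)
Lemma trop_line_vertex (c : R * R) :
  tropV V (line (rc m) (rc n)) = trop_line c -> c = vertex V m n.
Proof.
move=> E; have [t t0 vt] := ex_rval_gt0 V.
have L X Y Z : X + Y + Z = 0 -> X != 0 -> Y != 0 -> Z != 0 -> trop_line c
    ((vertex V m n).1 - rv X + rv Z, (vertex V m n).2 - rv Y + rv Z).
  by rewrite -E; exact: line_trop_point.
have u1 : vunit V (- 1 - t).
  apply/vunitP; have ot : integral V t by rewrite integralE (ltW vt) orbT.
  have o1 : integral V (-1) by rewrite integralN integral1.
  split; first exact: integralB.
  rewrite residueB// residueN ?integral1// residue1.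
  have -> : residue V t = 0 by apply/eqP/negPn; rewrite residue_neq0// gt_eqF.
  by move/eqP; rewrite subr0 oppr_eq0 oner_eq0.
have t1 := vunit_neq0 u1; have /andP[_ /eqP r1] := u1.
have r2 : rv 2 = 0 by exact: rval_nat.
have L0 := L 1 1 (-2); rewrite rvalN r2 rval1 oppr_eq0 pnatr_eq0 oner_eq0 in L0.
have /trop_lineP := L0 (ltac:(ring)) isT isT isT.
have /trop_lineP := L t (- 1 - t) 1 (ltac:(ring)) t0 t1 (oner_neq0 _).
have /trop_lineP := L (- 1 - t) t 1 (ltac:(ring)) t1 t0 (oner_neq0 _).
rewrite /= r1 rval1 => H1 H2 H0.
suff [e1 e2] : c.1 = (vertex V m n).1 /\ c.2 = (vertex V m n).2.
  by rewrite [LHS]surjective_pairing e1 e2.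
rewrite /vertex /=; case: H0 => -[h1 h2].
- by case: H1 => -[*]; split; lra.
- by case: H2 => -[*]; split; lra.
- by case: H2 => -[*]; split; lra.
Qed.

End TropicalLineVertex.

(** * Exclusion of conjugate tangency points, and conclusion *)

Lemma no_conjugate_tangency (R : realType) (KR : rcfType) (V : valued_field R KR)
    (q : {poly {poly KR}}) (c : R * R) (m n : KR) (p p' : KR[i] * KR[i]) :
  quartic q -> trop_smooth V (to_closure q) -> generic V (to_closure q) ->
  trop_bitangent V (to_closure q) c ->
  bitangent_triple (to_closure q) (real_complex KR m) (real_complex KR n) p p' ->
  lifts_line V (to_closure q) c (real_complex KR m) (real_complex KR n) p p' ->
  in_base p.1.
Proof.
move=> qq smooth [star _ same_end] bit tr [lineE tp tp' tang].
apply: contrapT => nb; have p'E := conjugate_tangency qq tr nb.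
have [mn0 _ _ _] := tr; move: mn0; rewrite !fmorph_eq0 => -[m0 n0].
have PE : trop_point V p' = trop_point V p by rewrite p'E /trop_point /= !trop_conj.
have pp' : p != p'.
  by apply: contra_not_neq nb => E; apply/in_baseP; rewrite [in RHS]E p'E.
have [[[pc|[d _ dP]] _] _ _ _] := tang; last first.
  (* Both tangency points tropicalize to the same point of an open end, while [p] and [p'] solve the
     two local systems with the same line. *)
  apply: (same_end _ _ _ d bit tang) => //; first by rewrite PE.
  exists (real_complex KR m), (real_complex KR n), p, p'; split=> //.
  - by rewrite !fmorph_eq0.
  - by split=> //; exact: local_tangency_triple tr.
  - by split=> //; apply: local_tangency_triple (bitangent_tripleC tr).
have cE := trop_line_vertex m0 n0 lineE; subst c.
have pl := bitangent_triple_on_line tr; have [k fE] := bitangent_factor tr.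
case: p pl nb pc p'E fE {PE pp' tr tp tang} => [[a b] p2] /= -> nb [t1 t2] -> fE.
have b0 : b != 0.
  by apply: contra_not_neq nb => ->; exists a.
have [k' square] := rescaled_form_square qq m0 n0 b0 fE.
have [S00 _ _] := in_support_corners smooth.
have [u0 u0c] := newton_cell_neq0 V (vertex V m n) S00.
(* If [x + iy] and [s] have the same tropicalization, the norm of their quotient is a unit. This is
   applied to [p.1] with [m / n] and to [p.2] with [m]. *)
have unitN (x y s : KR) : y != 0 -> s != 0 ->
    - rval V (x ^+ 2 + y ^+ 2) / 2 = - rval V s ->
    vunit V ((x / s) ^+ 2 + (y / s) ^+ 2).
  move=> y0 s0 h; rewrite !exprMn -mulrDl.
  have xy0 : x ^+ 2 + y ^+ 2 != 0.
    by rewrite paddr_eq0 ?sqr_ge0// !expf_eq0 /= (negbTE y0) andbF.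
  rewrite /vunit mulf_neq0 ?expf_neq0 ?invr_eq0//=.
  rewrite rvalM ?expf_neq0 ?invr_eq0// rvalX ?invr_eq0// rvalV// mulr2n.
  by apply/eqP; lra.
apply: (vertex_contradiction qq m0 n0 smooth u0c _ _ _ _ square star).
- have -> : (a * n / m) ^+ 2 + (b * n / m) ^+ 2 = (a / (m / n)) ^+ 2 + (b / (m / n)) ^+ 2.
    by congr (_ ^+ 2 + _ ^+ 2); field; rewrite ?m0 ?n0.
  apply: unitN; rewrite ?mulf_neq0 ?invr_eq0//.
  rewrite rvalM ?invr_eq0// rvalV//; move: t1; rewrite /trop /= -/(rval V _) => ->.
  by rewrite /vertex /=; ring.
- have -> : (1 + a * n / m) ^+ 2 + (b * n / m) ^+ 2 =
      ((- m - n * a) / m) ^+ 2 + ((- (n * b)) / m) ^+ 2.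
    by field; rewrite ?m0.
  apply: unitN; rewrite ?oppr_eq0 ?mulf_neq0//.
  suff zE : - real_complex KR m - real_complex KR n * Complex a b =
      Complex (- m - n * a) (- (n * b)) by rewrite zE in t2.
  by apply/eqP; rewrite eq_complex /= !mul0r subr0 addr0 oppr0 add0r !eqxx.
- by rewrite addr_ge0 ?sqr_ge0.
- by rewrite addr_ge0 ?sqr_ge0.
Qed.

Unset Implicit Arguments.

Theorem theorem7p1 (R : realType) (KR : rcfType) (V : valued_field R KR)
  (q : {poly {poly KR}}) (c : R * R) (m n : KR[i]) (p p' : KR[i] * KR[i]) :
  quartic q ->
  trop_smooth V (to_closure q) ->
  generic V (to_closure q) ->
  trop_bitangent V (to_closure q) c ->
  bitangent_triple (to_closure q) m n p p' ->
  lifts_line V (to_closure q) c m n p p' ->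
  in_base m -> in_base n ->
  (in_base p.1 /\ in_base p.2) /\ (in_base p'.1 /\ in_base p'.2).
Proof.
move=> qq smooth gen bit tr lifts [m0 mE] [n0 nE]; rewrite {}mE {}nE in tr lifts.
have p1 := no_conjugate_tangency qq smooth gen bit tr lifts.
have p1' : in_base p'.1.
  (* Otherwise [p] would be the conjugate of [p'], and [p.1] being real would make [p'.1] real. *)
  apply: contrapT => nb; apply: (nb); move: p1.
  rewrite (conjugate_tangency qq (bitangent_tripleC tr) nb) /= => /in_baseP.
  by rewrite conjcK => h; apply/in_baseP.
have on p3 p4 : bitangent_triple (to_closure q) (real_complex KR m0) (real_complex KR n0) p3 p4 ->
    in_base p3.1 -> in_base p3.2.
  move=> /bitangent_triple_on_line -> [x ->]; exists (- m0 - n0 * x).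
  by rewrite rmorphB rmorphN rmorphM.
by split; split=> //; [exact: on tr p1|exact: on (bitangent_tripleC tr) p1'].
Qed.
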